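(* Let $\mathcal F_m(M)$ be a one-parameter exponential family with mean parameters in $(0,M]$, whose log-partition function $b$ is twice differentiable with continuous second derivative $b''>0$ on $\Theta$, and whose variance function $V$ satisfies, for some $C_L>0$, $|V(\mu)-V(\mu')|\le C_L|\mu-\mu'|$ for all $\mu,\mu'\in(0,M]$. Then there is a constant $C>0$, depending only on $C_L$ and $M$, such that for every $K\ge2$, every $T\ge2$, and every $K$-armed bandit problem whose reward distributions all belong to the (known) family $\mathcal F_m(M)$, the algorithm Exp-KL-MS satisfies $$\mathrm{Reg}(T)\le C\Big(\sqrt{V(\mu_{\max})\,K\,T\ln K}+K\ln T\Big).$$
   Context: Exponential family: given a base measure $m$ on $\mathbb R$, $\{p_\theta(dx)=m(dx)\exp(x\theta-b(\theta)):\theta\in\Theta\}$, where $\Theta\subset\mathbb R$ is an interval and $b(\theta)=\ln\int_{\mathbb R}e^{x\theta}m(dx)$. Members are determined by their mean $b'(\theta)$. The variance function $V(\mu)$ is the variance of the member with mean $\mu$. $\mathrm{KL}(\mu,\mu')$ denotes the Kullback–Leibler divergence $\mathbb E_{X\sim\nu}[\ln\frac{d\nu}{d\nu'}(X)]$ between the members $\nu,\nu'$ with means $\mu,\mu'$. Bandit: each arm $a\in[K]=\{1,\dots,K\}$ has reward distribution $\nu_a$ in the family with mean $\mu_a$; $\mu_{\max}=\max_a\mu_a$. In round $t=1,\dots,T$ the agent picks $I_t\in[K]$ (based on the past and internal randomness) and receives $r_t\sim\nu_{I_t}$, independent of the past given $I_t$. $N_{t,a}=\sum_{i\le t}\mathbf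 1\{I_i=a\}$, $\hat\mu_{t,a}=\frac1{N_{t,a}}\sum_{i\le t}r_i\mathbf 1\{I_i=a\}$, $\hat\mu_{t,\max}=\max_a\hat\mu_{t,a}$. It is assumed that empirical means are means of members of the exponential family (so that the divergences in the algorithm make sense). Regret: $\mathrm{Reg}(T)=\mathbb E\big[\sum_{t=1}^T(\mu_{\max}-\mu_{I_t})\big]$. Exp-KL-MS: in rounds $t\le K$ pull $I_t=t$; in each round $t>K$ pull $I_t=a$ with probability $p_{t,a}=\exp\!\big(-L(N_{t-1,a})\,\mathrm{KL}(\hat\mu_{t-1,a},\hat\mu_{t-1,\max})\big)/M_t$, where $L(k)=k-1$ and $M_t$ normalizes the probabilities to sum to $1$. *)

(* Defs.v *)
(* MathComp-Analysis world *)
From HB Require Import structures.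
From mathcomp Require Import all_boot all_order all_algebra.
From mathcomp Require Import all_classical all_reals all_analysis.

Set Implicit Arguments.
Unset Strict Implicit.
Unset Printing Implicit Defensive.

Import Order.TTheory GRing.Theory Num.Theory.
Import numFieldNormedType.Exports.

Local Open Scope classical_set_scope.
Local Open Scope ring_scope.

(** * One-parameter exponential families *)

Definition log_partition (R : realType) (m : {measure set R -> \bar R})
    (theta : R) : R :=
  ln (fine (\int[m]_x (expR (x * theta))%:E)%E).

(* [memberE] forces 0 < \int e^(x theta) dm < +oo on [params]: otherwise the
   right-hand side taken on the whole line is 0 or +oo.  Nothing is said about
   [member theta] for theta outside [params]. *)
Record exp_family (R : realType) := ExpFamily {
  base : {measure set R -> \bar R} ;
  params : set R ;
  params_itv : is_interval params ;
  member : R -> probability R R ;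
  memberE : forall theta, params theta -> forall A, measurable A ->
    member theta A =
      (\int[base]_(x in A) (expR (x * theta - log_partition base theta))%:E)%E
}.

Section exp_family_theory.
Variables (R : realType) (F : exp_family R).

Definition mean (theta : R) : R := fine 'E_(member F theta)[id]%E.

Definition means : set R := mean @` params F.

(* The parameter of the member with mean mu.  The default value, used when mu is
   not in [means], is itself an element of [params]. *)
Definition param_of (mu : R) : R :=
  xget (xget 0 (params F)) [set theta | params F theta /\ mean theta = mu].

Definition variance_fun (mu : R) : R :=
  fine 'V_(member F (param_of mu))[id]%E.

(* The members of F with mean in ]0, M]. *)
Definition bounded_params (M : R) : set R :=
  [set theta | params F theta /\ 0 < mean theta <= M].

Definition lipschitz_variance (C_L M : R) : Prop :=
  forall mu mu', means mu -> means mu' -> 0 < mu <= M -> 0 < mu' <= M ->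
    `|variance_fun mu - variance_fun mu'| <= C_L * `|mu - mu'|.

End exp_family_theory.

(* Derivative relative to D: one-sided at an endpoint of an interval D, and the
   usual derivative at interior points. *)
Definition is_derive_within (R : realType) (D : set R) (f : R -> R) (x l : R)
    : Prop :=
  (f y - f x) / (y - x) @[y --> within D x^'] --> l.

Definition regular_log_partition (R : realType) (F : exp_family R) : Prop :=
  exists b1 b2 : R -> R,
    [/\ forall theta, params F theta ->
          is_derive_within (params F) (log_partition (base F)) theta (b1 theta),
        forall theta, params F theta ->
          is_derive_within (params F) b1 theta (b2 theta),
        {within params F, continuous b2} &
        forall theta, params F theta -> 0 < b2 theta].

(** * Kullback-Leibler divergence *)

Definition kl_divergence d (T : measurableType d) (R : realType)
    (nu nu' : probability T R) : \bar R :=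
  (\int[nu]_x
     (ln (fine (Radon_Nikodym (charge_of_finite_measure nu) nu' x)))%:E)%E.

Definition KL (R : realType) (F : exp_family R) (mu mu' : R) : R :=
  fine (kl_divergence (member F (param_of F mu)) (member F (param_of F mu'))).

(** * Bandit interaction *)

(* q is a version of the conditional probability of A given the sigma-algebra G *)
Definition is_cond_prob d (Om : measurableType d) (R : realType)
    (P : probability Om R) (G : set (set Om)) (A : set Om) (q : Om -> R)
    : Prop :=
  (forall B : set R, measurable B -> G (q @^-1` B)) /\
  (forall H, G H -> P (A `&` H) = (\int[P]_(w in H) (q w)%:E)%E).

(* The maximum over arms; the index set is finite and, for 0 < K, nonempty. *)
Definition max_arm (R : realType) (K : nat) (f : 'I_K -> R) : R :=
  sup (range f).

Section interaction.
Variables (R : realType) (F : exp_family R) (K : nat).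
Variables (d : measure_display) (Om : measurableType d).

(* I t and r t are the arm pulled and the reward received in round t; rounds are
   numbered from 1, so the values at t = 0 are never used.  Arms are numbered
   from 0. *)
Variables (I : nat -> Om -> 'I_K) (r : nat -> Om -> R).

Definition pulls (t : nat) (a : 'I_K) (w : Om) : nat :=
  \sum_(1 <= i < t.+1) (I i w == a).

Definition emp_mean (t : nat) (a : 'I_K) (w : Om) : R :=
  (\sum_(1 <= i < t.+1 | I i w == a) r i w) / (pulls t a w)%:R.

Definition emp_max (t : nat) (w : Om) : R :=
  max_arm (fun a => emp_mean t a w).

Definition weight (t : nat) (a : 'I_K) (w : Om) : R :=
  expR (- ((pulls t.-1 a w)%:R - 1)
          * KL F (emp_mean t.-1 a w) (emp_max t.-1 w)).

Definition exp_kl_ms (t : nat) (a : 'I_K) (w : Om) : R :=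
  if (t <= K)%N then (a.+1 == t)%:R
  else weight t a w / \sum_(a' < K) weight t a' w.

Definition past_events (t : nat) : set (set Om) :=
  [set A | exists2 i, (1 <= i < t)%N &
    (exists a, A = I i @^-1` [set a]) \/
    (exists2 B, measurable B & A = r i @^-1` B)].

(* sigma(I_1, r_1, ..., I_(t-1), r_(t-1)) *)
Definition history (t : nat) : set (set Om) := <<s past_events t >>.

(* sigma(I_1, r_1, ..., I_(t-1), r_(t-1), I_t) *)
Definition history_arm (t : nat) : set (set Om) :=
  <<s past_events t `|` [set A | exists a, A = I t @^-1` [set a]] >>.

(* (I_t, r_t) for 1 <= t <= T is a run of Exp-KL-MS on the bandit whose arm a has
   reward distribution nu a.  The past is the observed history only: this
   determines the joint law of arms and rewards, whatever the internal
   randomness. *)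
Record exp_kl_ms_run (P : probability Om R) (nu : 'I_K -> probability R R)
    (T : nat) : Prop := ExpKLMSRun {
  run_measI : forall t a, (1 <= t <= T)%N -> measurable (I t @^-1` [set a]) ;
  run_measr : forall t, (1 <= t <= T)%N -> measurable_fun setT (r t) ;
  run_arm : forall t a, (1 <= t <= T)%N ->
    is_cond_prob P (history t) (I t @^-1` [set a]) (exp_kl_ms t a) ;
  run_reward : forall t (B : set R), (1 <= t <= T)%N -> measurable B ->
    is_cond_prob P (history_arm t) (r t @^-1` B)
      (fun w => fine (nu (I t w) B)) ;
  run_emp_mean : {ae P, forall w, forall t a, (1 <= t <= T)%N ->
    (0 < pulls t a w)%N -> means F (emp_mean t a w)}
}.

Definition regret (P : probability Om R) (mu : 'I_K -> R) (T : nat) : \bar R :=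
  ('E_P[fun w => (\sum_(1 <= t < T.+1) (max_arm mu - mu (I t w)))%R])%E.

End interaction.

(* Main.v *)
Require Import Defs.
From mathcomp Require Import all_boot all_order all_algebra.
From mathcomp Require Import all_classical all_reals all_analysis.
From mathcomp Require Import measurable_realfun.
From mathcomp Require Import ring lra.

Set Implicit Arguments.
Unset Strict Implicit.
Unset Printing Implicit Defensive.

Import Order.TTheory GRing.Theory Num.Theory.
Import numFieldNormedType.Exports.

Local Open Scope classical_set_scope.
Local Open Scope ring_scope.

(** Fix an arm [a] with gap [D] to the best arm [o], and members [s1], [s2] with
    means [mu_a + D/3] and [mu_max - D/3].  Since the second derivative of the
    log-partition function is the variance, which is at most
    [V(mu_max) + C_L * D] between [mu_a] and [mu_max], the divergences from [s1]
    to [a], from [s1] to [s2] and from [s2] to [o] are at least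
    [x = D^2 / (18 * (V(mu_max) + C_L * D))].  A pull of [a] after round [K] has
    one of four causes: [a] has few pulls; its empirical mean exceeds that of
    [s1]; its empirical mean is low and the largest one is above that of [s2], so
    that the algorithm hardly selects [a]; or all empirical means are below that
    of [s2].  In the last case [a] is selected at most
    [exp ((N_o - 1) * kl)] times as often as [o], where [kl] is the divergence
    from the empirical mean of [o] to [s2].  Peeling over the size of [N_o] and of
    [kl], and using that a given value of [N_o] is left only once, bounds the
    number of such pulls by a multiple of [(1 + ln (1 + T * x)) / x].  Deviations
    of empirical means are controlled by [sum_t E(1_(A_t) * Z_(t-1)) <= 1], for
    disjoint predictable events [A_t] and a likelihood-ratio martingale [Z].
    Finally the arms with gap below [sqrt (V(mu_max) * K * ln K / T)] cost at most
    [T] times this gap in total. *)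

(** Obtaining [ln K] instead of [ln T] dictates the form of the peeling. While [N_o] lies in [[4^i,
    4^(i+1)[], levels of width [4^-i] lose only a factor [exp 4] per cell, and about
    [ln (1 + T / 4^i)] levels suffice before the remaining tail is small enough to be multiplied by
    [T]. A block costs about [4^i * ln (1 + T / 4^i) * exp (- 4^i * x)]; the sum over [i] is
    governed by the scale [4^i ~ 1 / x], whence [ln (1 + T * x)]. At the threshold gap, [T * x] is
    at most [K * ln K]. The factor [exp (- 4^i * x)] is the reason for [s2]: divergence is
    superadditive along the way from the empirical mean through [s2] to [o], so the margin between
    [s2] and [o] survives when the ratio of selection probabilities cancels the deviation bound. The
    18 is [2 * 3^2], from [(D / 3)^2 / (2 * W)]. No moment is given in advance: finiteness of the
    mean, its equality with the derivative of the log-partition function and a lower bound on the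
    variance are derived through monotone dyadic difference quotients. *)

(** * Integration against densities and image measures *)

Section pushforward_density.
Context d d' (T : measurableType d) (T' : measurableType d') (R : realType).
Variables (mu : {measure set T -> \bar R}) (nu : {measure set T' -> \bar R}).
Variables (phi : T -> T') (g : T -> R).
Hypothesis mphi : measurable_fun setT phi.
Hypothesis mg : measurable_fun setT g.
Hypothesis g0 : forall x, 0 <= g x.
Hypothesis nuE : forall A, measurable A ->
  nu A = (\int[mu]_(x in phi @^-1` A) (g x)%:E)%E.

Import HBNNSimple.

(** Simple functions and monotone convergence. With [phi] the identity it handles densities between
    members; with [phi] a reward and [g] an indicator it handles conditional laws; with [phi] the
    identity onto a coarser sigma-algebra it handles conditioning. *)
Lemma ge0_integral_pushforward_density (f : T' -> \bar R) : measurable_fun setT f ->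
  (forall x, 0 <= f x)%E ->
  (\int[nu]_x f x = \int[mu]_x (f (phi x) * (g x)%:E))%E.
Proof.
move=> mf f0.
pose h := nnsfun_approx measurableT mf.
have hf x : (EFin \o h n) x @[n --> \oo] --> f x.
  by apply: cvg_nnsfun_approx.
have mEg : measurable_fun setT (EFin \o g) by exact/measurable_EFinP.
have -> : (\int[nu]_x f x = lim (\int[nu]_x (EFin \o h n) x @[n --> \oo]))%E.
  under eq_integral => x _ do rewrite -(cvg_lim _ (hf x))//.
  apply: monotone_convergence => //.
  - by move=> n; apply/measurable_EFinP.
  - by move=> n x _ //=; rewrite lee_fin.
  - by move=> x _ a b ab; rewrite lee_fin; exact/lefP/nd_nnsfun_approx.
have hfg x : ((EFin \o h n) (phi x) * (g x)%:E)%E @[n --> \oo] -->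
    (f (phi x) * (g x)%:E)%E.
  exact: cvgeZr.
have mhphi n : measurable_fun setT (h n \o phi) by exact: measurableT_comp.
have -> : (\int[mu]_x (f (phi x) * (g x)%:E) =
    lim (\int[mu]_x ((EFin \o h n) (phi x) * (g x)%:E) @[n --> \oo]))%E.
  under eq_integral => x _ do rewrite -(cvg_lim _ (hfg x))//.
  apply: monotone_convergence => [//| | |].
  - move=> n; apply/emeasurable_funM => //.
    exact/measurable_EFinP/mhphi.
  - by move=> n x Ex /=; rewrite mule_ge0 ?lee_fin.
  - move=> x Ex a b ab/=; rewrite lee_wpmul2r ?lee_fin//.
    exact/lefP/nd_nnsfun_approx.
suff suf n : (\int[mu]_x ((EFin \o h n) (phi x) * (g x)%:E) =
    \int[nu]_x (EFin \o h n) x)%E.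
  by under [in RHS]eq_fun do rewrite suf.
have mpre y : measurable (phi @^-1` (h n @^-1` [set y])).
  by rewrite -[X in measurable X]setTI; exact: mphi.
transitivity (\int[nu]_x
   (\sum_(y \in range (h n)) (y * \1_(h n @^-1` [set y]) x)%:E))%E; last first.
  by apply: eq_integral => t tE; rewrite /= fimfunE -fsumEFin.
rewrite ge0_integral_fsum//; last 2 first.
- by move=> r; apply/measurable_EFinP; exact: measurable_funM.
- by move=> m y Ey; exact: nnfun_muleindic_ge0.
transitivity (\int[mu]_x (\sum_(y \in range (h n))
    (y * \1_(h n @^-1` [set y]) (phi x))%:E * (g x)%:E))%E.
  under [RHS]eq_integral => x xE.
    rewrite -ge0_mule_fsuml => [|y]; last exact: nnfun_muleindic_ge0.
    rewrite fsumEFin // -(fimfunE _ (phi x)); over.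
  by [].
have mind y : measurable_fun setT
    (fun x => (y * \1_(h n @^-1` [set y]) (phi x))%:E).
  apply/measurable_EFinP; apply: measurable_funM => //.
  exact: (@measurable_indic _ _ _ setT (phi @^-1` (h n @^-1` [set y])) (mpre y)).
rewrite ge0_integral_fsum//; last 2 first.
- by move=> y; exact: emeasurable_funM.
- move=> m y Ey; rewrite mule_ge0 ?lee_fin// -lee_fin.
  exact: nnfun_muleindic_ge0.
apply: eq_fsbigr => r rhn.
under [RHS]eq_integral do rewrite EFinM.
rewrite integralZl_indic_nnsfun => //.
under eq_integral do rewrite EFinM -muleA.
rewrite ge0_integralZl//.
- under eq_integral do rewrite muleC.
  rewrite (eq_integral ((EFin \o g) \_ (phi @^-1` (h n @^-1` [set r])))); last first.
    by move=> x xE; rewrite epatch_indic.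
  by rewrite -integral_mkcond -nuE// integral_indic// setIT.
- apply: emeasurable_funM => //; apply/measurable_EFinP.
  exact: (@measurable_indic _ _ _ setT (phi @^-1` (h n @^-1` [set r])) (mpre r)).
- by move=> t Et; rewrite mule_ge0 ?lee_fin.
- by move: rhn; rewrite inE => -[t _ <-]; rewrite lee_fin.
Qed.

End pushforward_density.

Section density.
Context d (T : measurableType d) (R : realType).
Variables (mu nu : {measure set T -> \bar R}) (g : T -> R).
Hypothesis mg : measurable_fun setT g.
Hypothesis g0 : forall x, 0 <= g x.
Hypothesis nuE : forall A, measurable A -> nu A = (\int[mu]_(x in A) (g x)%:E)%E.

Lemma ge0_integral_density (f : T -> \bar R) : measurable_fun setT f ->
  (forall x, 0 <= f x)%E ->
  (\int[nu]_x f x = \int[mu]_x (f x * (g x)%:E))%E.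
Proof. exact: (@ge0_integral_pushforward_density _ _ _ _ _ mu nu id). Qed.

End density.

(** * Derivatives and difference quotients *)

Section is_derive_within.
Context {R : realType}.
Implicit Types (D : set R) (f : R -> R) (x l : R).

Lemma is_derive_withinP D f x l : is_derive_within D f x l <->
  forall e, 0 < e -> exists2 r, 0 < r & forall y, D y -> y != x ->
    `|y - x| < r -> `|(f y - f x) / (y - x) - l| < e.
Proof.
split=> [+ e e0|h].
  move=> /cvgrPdist_lt/(_ e e0)[]/= r r0 rh; exists r => // y Dy yx xyr.
  rewrite distrC; apply: (rh y) => //.
  by rewrite /ball_/= distrC.
apply/cvgrPdist_lt => e /h[r r0 rh]; exists r => //= y xyr yx Dy.
by rewrite distrC rh// distrC.
Qed.

Lemma is_derive_within_cvg D f x l (u : nat -> R) : is_derive_within D f x l ->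
  (forall n, D (u n)) -> (forall n, u n != x) -> u n @[n --> \oo] --> x ->
  (f (u n) - f x) / (u n - x) @[n --> \oo] --> l.
Proof.
move=> /is_derive_withinP h Du ux ucvg; apply/cvgrPdist_lt => e /h[r r0 rh].
move/cvgrPdist_lt : ucvg => /(_ r r0); apply: filterS => n unr.
by rewrite distrC rh// distrC.
Qed.

Lemma is_derive_within_is_derive D f x l a c : is_derive_within D f x l ->
  (forall y, a < y < c -> D y) -> a < x < c -> is_derive x (1 : R) f l.
Proof.
move=> /is_derive_withinP h acD /andP[ax xc].
suff: h^-1 *: ((f \o shift x) h%:A - f x) @[h --> 0^'] --> l.
  move=> H; split; last exact/cvg_lim.
  by apply/cvg_ex; exists l.
apply/cvgrPdist_lt => e /h[r r0 rh].
exists (Order.min r (Order.min (x - a) (c - x))) => /=.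
  by rewrite !lt_min r0 !subr_gt0 ax.
move=> y /=; rewrite sub0r normrN !lt_min => /and3P[yr yxa ycx] y0.
have := rh (y + x).
rewrite addrK distrC mulrC /= scaler1; apply => //.
- apply: acD; move: yxa ycx; rewrite !ltr_norml => /andP[? ?] /andP[? ?].
  by apply/andP; split; lra.
- by apply: contra_neq y0 => H; apply: (addIr x); rewrite add0r.
Qed.

Lemma is_derive_within_continuous D f (f' : R -> R) :
  (forall x, D x -> is_derive_within D f x (f' x)) -> {within D, continuous f}.
Proof.
move=> h; apply/subspace_continuousP => x Dx.
apply/cvgrPdist_lt => e e0.
have /is_derive_withinP/(_ 1 ltr01)[r r0 rh] := h x Dx.
have k0 : 0 < `|f' x| + 1 by rewrite ltr_wpDl.
exists (Order.min r (e / (`|f' x| + 1))) => /=.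
  by rewrite lt_min r0 divr_gt0.
move=> y /=; rewrite lt_min => /andP[xyr xye] Dy.
have [->|yx] := eqVneq y x; first by rewrite subrr normr0.
have := rh y Dy yx; rewrite distrC => /(_ xyr) hh.
rewrite distrC -(divfK (_ : y - x != 0) (f y - f x)) ?subr_eq0//.
rewrite normrM (distrC y x).
rewrite ltr_pdivlMr// mulrC in xye.
apply: le_lt_trans xye; rewrite ler_wpM2r//.
rewrite -[X in `|X|](subrK (f' x)) (le_trans (ler_normD _ _))//.
by rewrite addrC lerD2l ltW.
Qed.

End is_derive_within.

Lemma ger0_is_derive_le {R : realType} (f f' : R -> R) (a c : R) : a <= c ->
  (forall x, a < x < c -> is_derive x (1 : R) f (f' x)) ->
  (forall x, a < x < c -> 0 <= f' x) ->
  {within `[a, c], continuous f} -> f a <= f c.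
Proof.
rewrite le_eqVlt => /predU1P[->//|ac] df f'0 cf.
have dfi x : x \in `]a, c[ -> is_derive x 1 f (f' x) by rewrite in_itv => /df.
have [x xac e] := MVT ac dfi cf.
by rewrite -subr_ge0 e mulr_ge0 ?subr_ge0 ?(ltW ac)// f'0//; rewrite in_itv/= in xac.
Qed.

Lemma gtr0_is_derive_lt {R : realType} (f f' : R -> R) (a c : R) : a < c ->
  (forall x, a < x < c -> is_derive x (1 : R) f (f' x)) ->
  (forall x, a < x < c -> 0 < f' x) ->
  {within `[a, c], continuous f} -> f a < f c.
Proof.
move=> ac df f'0 cf.
have dfi x : x \in `]a, c[ -> is_derive x 1 f (f' x) by rewrite in_itv => /df.
have [x xac e] := MVT ac dfi cf.
by rewrite -subr_gt0 e mulr_gt0 ?subr_gt0// f'0//; rewrite in_itv/= in xac.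
Qed.

Section exp_bounds.
Context {R : realType}.
Implicit Types (y : R) (n : nat).

Lemma expRB1_le y : expR y - 1 <= y * expR y.
Proof.
have := expR_ge1Dx (- y); rewrite expRN.
rewrite -(ler_pM2r (expR_gt0 y)) mulVf ?gt_eqF ?expR_gt0//.
by rewrite mulrDl mul1r; lra.
Qed.

(* Difference quotients of [expR] at [0]. The increments are dyadic because
   halving the increment makes monotonicity an algebraic identity. *)
Definition dexp y n : R := 2 ^+ n * (expR (y / 2 ^+ n) - 1).

Lemma dexp_ge y n : y <= dexp y n.
Proof.
rewrite /dexp -[leLHS](mulfVK (_ : 2 ^+ n != 0)) ?expf_neq0// mulrC.
rewrite ler_pM2l ?exprn_gt0//.
by have := expR_ge1Dx (y / 2 ^+ n); lra.
Qed.

Lemma dexpS y n : dexp y n = dexp y n.+1 + 2 ^+ n * (expR (y / 2 ^+ n.+1) - 1) ^+ 2.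
Proof.
rewrite /dexp; have -> : y / 2 ^+ n = 2 * (y / 2 ^+ n.+1).
  by rewrite exprS; field; rewrite expf_neq0.
by rewrite expRM_natl; set e := expR _; rewrite (exprS 2); ring.
Qed.

Lemma cvg_div2Xn y : y / 2 ^+ n @[n --> \oo] --> (0 : R).
Proof.
rewrite -[X in _ --> X](mulr0 y); apply: cvgM; first exact: cvg_cst.
have : (2^-1 : R) ^+ n @[n --> \oo] --> 0.
  by apply: cvg_expr; rewrite ger0_norm// invf_lt1 ?ltr1n.
by under eq_fun do rewrite exprVn.
Qed.

Lemma cvg_expR_div2Xn y : expR (y / 2 ^+ n) @[n --> \oo] --> (1 : R).
Proof.
have := @continuous_expR R 0; rewrite /continuous_at expR0; apply: cvg_trans.
exact: (cvg_comp _ _ (cvg_div2Xn y)).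
Qed.

Lemma cvg_dexp y : dexp y n @[n --> \oo] --> y.
Proof.
apply: (@squeeze_cvgr _ _ _ _ (fun=> y) (fun n => y * expR (y / 2 ^+ n))).
- apply: nearW => n; rewrite dexp_ge/=.
  rewrite /dexp -ler_pdivlMl ?exprn_gt0// (le_trans (expRB1_le _))//.
  by rewrite mulrA (mulrC y).
- exact: cvg_cst.
- rewrite -[X in _ --> X](mulr1 y); apply: cvgM; first exact: cvg_cst.
  exact: cvg_expR_div2Xn.
Qed.

(** Symmetric second difference quotient at 0 of [t |-> expR (t * y)], with increment [2^-n]. Its
    integral against a member is a second difference of the moment generating function. *)
Definition d2exp y n : R :=
  4 ^+ n * (expR (y / 2 ^+ n) + expR (- y / 2 ^+ n) - 2).

Lemma d2expE y n : d2exp y n = dexp y n ^+ 2 * expR (- y / 2 ^+ n).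
Proof.
rewrite /d2exp /dexp mulNr expRN (_ : 4 = 2 ^+ 2); last by rewrite -natrX.
by rewrite exprAC; field; rewrite gt_eqF ?expR_gt0.
Qed.

Lemma cvg_d2exp y : d2exp y n @[n --> \oo] --> y ^+ 2.
Proof.
rewrite (funext (d2expE y)) -(mulr1 (y ^+ 2)); apply: cvgM.
  by apply: cvgM; exact: cvg_dexp.
exact: cvg_expR_div2Xn.
Qed.

Lemma d2exp_nincr y : nonincreasing_seq (d2exp y).
Proof.
apply/nonincreasing_seqP => n; rewrite /d2exp.
rewrite exprSr -mulrA ler_pM2l ?exprn_gt0//.
have -> : y / 2 ^+ n = 2 * (y / 2 ^+ n.+1).
  by rewrite exprS; field; rewrite expf_neq0.
have -> : - y / 2 ^+ n = 2 * (- y / 2 ^+ n.+1).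
  by rewrite exprS; field; rewrite expf_neq0.
rewrite !expRM_natl mulNr expRN.
set e := expR _; have e0 : 0 < e by exact: expR_gt0.
rewrite -subr_ge0.
(* With [c = e + e^-1 - 2], doubling the increment turns [c] into [c^2 + 4 * c], so the difference
   is the square of [c = (e - 1)^2 / e]. *)
have -> : e ^+ 2 + e^-1 ^+ 2 - 2 - 4 * (e + e^-1 - 2) = ((e - 1) ^+ 2 / e) ^+ 2.
  by field; rewrite gt_eqF.
exact: sqr_ge0.
Qed.

Lemma dexp_nincr y : nonincreasing_seq (dexp y).
Proof.
apply/nonincreasing_seqP => n; rewrite (dexpS y n).
by rewrite lerDl mulr_ge0 ?sqr_ge0 ?exprn_ge0.
Qed.

End exp_bounds.

(** Monotone convergence applied to the nonnegative increasing functions [f_ 0 - f_ n]. The lower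
    bound [lb] keeps the limit finite, so integrability of [f] is a conclusion: this is how the
    moments of members are shown to exist. *)
Lemma nonincreasing_cvg_integral d (T : measurableType d) (R : realType)
    (mu : {measure set T -> \bar R}) (f_ : nat -> T -> R) (f : T -> R)
    (A_ : nat -> R) (lb : R) :
  (forall n, mu.-integrable setT (EFin \o f_ n)) ->
  (forall n, (\int[mu]_x (f_ n x)%:E = (A_ n)%:E)%E) ->
  (forall x, nonincreasing_seq (f_ ^~ x)) ->
  (forall x, f_ n x @[n --> \oo] --> f x) ->
  (forall n, lb <= A_ n) ->
  exists A, [/\ mu.-integrable setT (EFin \o f), (\int[mu]_x (f x)%:E = A%:E)%E,
    lb <= A & A_ n @[n --> \oo] --> A].
Proof.
move=> intf intE nif cvf Alb.
have mf_ n : measurable_fun setT (f_ n).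
  by have /(measurable_int mu)/measurable_EFinP := intf n.
have niA : nonincreasing_seq A_.
  move=> m n mn; rewrite -lee_fin -!intE.
  apply: le_integral => //; [exact: intf|exact: intf|move=> x _].
  by rewrite lee_fin; exact: nif.
have cvA : cvgn A_.
  apply: nonincreasing_is_cvgn => //.
  by exists lb => _ [n _ <-].
pose A := limn A_.
have AA : A_ n @[n --> \oo] --> A by [].
have lbA : lb <= A by apply: limr_ge => //; exact: nearW.
pose g n x : R := f_ 0%N x - f_ n x.
have mf : measurable_fun setT f.
  by apply: (measurable_fun_cvg mf_) => x _; exact: cvf.
have intg n : (\int[mu]_x (g n x)%:E = (A_ 0%N - A_ n)%:E)%E.
  by rewrite integralB_EFin// !intE.
have g0 n x : 0 <= g n x by rewrite subr_ge0; exact: nif.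
have mg n : measurable_fun setT (g n) by exact: measurable_funB.
have cvg_g x : g n x @[n --> \oo] --> f_ 0%N x - f x.
  by apply: cvgB; [exact: cvg_cst|exact: cvf].
have h0 x : 0 <= f_ 0%N x - f x.
  have := cvg_g x => /cvg_lim <-//; apply: limr_ge; last exact: nearW.
  by apply/cvg_ex; exists (f_ 0%N x - f x).
have H : (\int[mu]_x (f_ 0%N x - f x)%:E = (A_ 0%N - A)%:E)%E.
  have mono := @cvg_monotone_convergence _ _ _ mu setT measurableT
     (fun n => EFin \o g n).
  have /cvg_lim <- // : (\int[mu]_x (g n x)%:E)%E @[n --> \oo] -->
      (\int[mu]_x (f_ 0%N x - f x)%:E)%E.
    rewrite [X in _ --> X](_ : _ = \int[mu]_x limn (fun n => (g n x)%:E))%E.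
      apply: mono => [n|n x _|x _ m n mn].
      - exact/measurable_EFinP.
      - by rewrite lee_fin.
      - by rewrite lee_fin lerB//; exact: nif.
    apply: eq_integral => x _; apply/esym/cvg_lim => //.
    by apply: cvg_EFin; [exact: nearW|exact: cvg_g].
  under eq_fun do rewrite intg.
  apply/cvg_lim => //; apply: cvg_EFin; first exact: nearW.
  by apply: cvgB; [exact: cvg_cst|].
have inth : mu.-integrable setT (EFin \o (fun x => f_ 0%N x - f x)).
  apply/integrableP; split; first exact/measurable_EFinP/measurable_funB.
  under eq_integral => x _ do rewrite /= ger0_norm//.
  by rewrite H ltry.
have fE : f = (fun x => f_ 0%N x - (f_ 0%N x - f x)).
  by apply/funext => x; rewrite opprB addrC subrK.
have intf' : mu.-integrable setT (EFin \o f).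
  by rewrite fE; exact: (integrableB measurableT (intf 0%N) inth).
exists A; split => //.
rewrite fE (integralB_EFin measurableT (intf 0%N) inth) intE H.
by rewrite -EFinB opprB addrC subrK.
Qed.

(** The function [f (x + t) + f (x - t) - (l - e) * t^2] is nondecreasing for small [t >= 0]: its
    derivative is [f1 (x + t) - f1 (x - t) - 2 * (l - e) * t], and both difference quotients of [f1]
    at [x] exceed [l - e]. Differentiability of [f1] at the single point [x] is enough. *)
Lemma second_difference_ge {R : realType} (D : set R) (f f1 : R -> R)
    (x l e r : R) : 0 < e -> 0 < r ->
  (forall y, x - r < y < x + r -> D y) ->
  (forall y, x - r < y < x + r -> is_derive_within D f y (f1 y)) ->
  is_derive_within D f1 x l ->
  exists2 r', 0 < r' & forall s, 0 < s < r' ->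
    D (x + s) /\ D (x - s) /\ (l - e) * s ^+ 2 <= f (x + s) + f (x - s) - 2 * f x.
Proof.
move=> e0 r0 xD f1E /is_derive_withinP/(_ e e0)[k k0 kh].
exists (Order.min r k); first by rewrite lt_min r0.
move=> s; rewrite lt_min => /and3P[s0 sr sk].
split; first by apply: xD; lra.
split; first by apply: xD; lra.
have f1D y : x - r < y < x + r -> is_derive y (1 : R) f (f1 y).
  by move=> yr; apply: (is_derive_within_is_derive (f1E _ yr) xD).
pose g t := f (x + t) + f (x - t) - (l - e) * t ^+ 2.
pose g' t := f1 (x + t) - f1 (x - t) - 2 * (l - e) * t.
have gD t : - r < t < r -> is_derive t (1 : R) g (g' t).
  move=> tr.
  have D1 : is_derive t 1 (fun t => f (x + t)) (f1 (x + t)).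
    rewrite -[X in is_derive _ _ _ X]mulr1; apply: is_derive1_comp.
      by apply: f1D; lra.
    by have := @is_deriveD _ _ _ (cst x) id t 1 0 1 _ _; rewrite add0r; apply.
  have D2 : is_derive t 1 (fun t => f (x - t)) (- f1 (x - t)).
    rewrite -[X in is_derive _ _ _ X]mulrN1; apply: is_derive1_comp.
      by apply: f1D; lra.
    by have := @is_deriveB _ _ _ (cst x) id t 1 0 1 _ _; rewrite sub0r; apply.
  rewrite /g; apply: is_derive_eq; rewrite /g' /= !scaler1.
  rewrite /GRing.scale/=; ring.
have gc : {within `[0, s], continuous g}.
  apply: continuous_in_subspaceT => t; rewrite inE/= in_itv/= => ts.
  apply/differentiable_continuous/derivable1_diffP.
  by have [] : is_derive t (1 : R) g (g' t) by apply: gD; lra.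
have : g 0 <= g s.
  apply: (ger0_is_derive_le (ltW s0) _ _ gc (f' := g')) => t ts.
    by apply: gD; lra.
  have h1 := kh (x + t).
  have h2 := kh (x - t).
  have e1 : x + t - x = t by ring.
  have e2 : x - t - x = - t by ring.
  rewrite e1 in h1; rewrite e2 normrN in h2.
  have t0 : t != 0 by rewrite gt_eqF//; lra.
  have tn : `|t| < k by rewrite gtr0_norm; lra.
  have {}h1 : `|(f1 (x + t) - f1 x) / t - l| < e.
    by apply: h1 => //; [apply: xD; lra|rewrite -subr_eq0 e1].
  have {}h2 : `|(f1 (x - t) - f1 x) / - t - l| < e.
    by apply: h2 => //; [apply: xD; lra|rewrite -subr_eq0 e2 oppr_eq0].
  have tp : 0 < t by lra.
  move: h1 h2; rewrite invrN mulrN -mulNr !ltr_distl !ltr_pdivrMr// !ltr_pdivlMr//.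
  rewrite /g'; lra.
rewrite /g subr0 addr0 expr0n/= mulr0 subr0; lra.
Qed.

(** * Moments of an exponential family *)

Section exp_family_integrals.
Context {R : realType} (F : exp_family R).
Local Notation b := (log_partition (base F)).

Lemma measurable_expR_affine (t c : R) :
  measurable_fun setT (fun x : R => expR (t * x - c)).
Proof.
apply: measurableT_comp => //; apply: measurable_funB => //.
Qed.

(** Taking a member as reference removes the base measure, which may be infinite, from all later
    integrals. *)
Lemma member_density theta theta' A : params F theta -> params F theta' ->
  measurable A -> (member F theta' A =
  \int[member F theta]_(x in A)
    (expR ((theta' - theta) * x - (b theta' - b theta)))%:E)%E.
Proof.
move=> pt pt' mA; rewrite (memberE pt')// integral_mkcond [RHS]integral_mkcond.
have mf : measurable_fun setT
    (fun x : R => expR ((theta' - theta) * x - (b theta' - b theta))).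
  exact: measurable_expR_affine.
have mg : measurable_fun setT (fun x : R => expR (x * theta - b theta)).
  by under eq_fun do rewrite mulrC; exact: measurable_expR_affine.
rewrite (ge0_integral_density mg _ (memberE pt)); last 3 first.
- by move=> x; exact: expR_ge0.
- apply/(measurable_restrictT _ _).1 => //.
  by apply: measurable_funTS; exact/measurable_EFinP.
- by move=> x; apply: erestrict_ge0 => y _; rewrite lee_fin expR_ge0.
apply: eq_integral => x _; rewrite /patch; case: ifPn => _; last by rewrite mul0e.
rewrite -EFinM -expRD; congr (expR _)%:E; ring.
Qed.

(** The member at [theta + delta] has total mass one; the exponential tilt turns this into a moment
    generating function. *)
Lemma member_mgf theta delta : params F theta -> params F (theta + delta) ->
  (\int[member F theta]_x (expR (delta * x))%:E =
   (expR (b (theta + delta) - b theta))%:E)%E.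
Proof.
move=> pt pt'; have := member_density pt pt' measurableT.
rewrite probability_setT; set c := _ - b theta => H.
have -> : (expR c)%:E = ((expR c)%:E * 1)%E :> \bar R by rewrite mule1.
rewrite H -ge0_integralZl_EFin ?expR_ge0//.
- apply: eq_integral => x _; rewrite -EFinM -expRD; congr (expR _)%:E; ring.
- by apply/measurable_EFinP; exact: measurable_expR_affine.
Qed.

Lemma integrable_member_mgf theta delta :
  params F theta -> params F (theta + delta) ->
  (member F theta).-integrable setT (fun x : R => (expR (delta * x))%:E).
Proof.
move=> pt pt'; apply/integrableP; split.
  by apply/measurable_EFinP; apply: measurableT_comp.
rewrite (_ : integral _ _ _ = (expR (b (theta + delta) - b theta))%:E) ?ltry//.
rewrite -member_mgf//; apply: eq_integral => x _ /=.
by rewrite ger0_norm ?expR_ge0.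
Qed.

Lemma params_between theta theta' t : params F theta -> params F theta' ->
  theta <= t <= theta' -> params F t.
Proof. by move=> p p' tt; exact: (@params_itv R F theta theta'). Qed.

Lemma params_div2Xn theta delta n : params F theta -> params F (theta + delta) ->
  params F (theta + delta / 2 ^+ n).
Proof.
move=> p p'; have ge1 : 1 <= 2 ^+ n :> R by rewrite exprn_ege1// ler1n.
have gt0 : 0 < 2 ^+ n :> R by rewrite exprn_gt0.
have i1 : (2 ^+ n)^-1 <= 1 :> R by rewrite invf_le1.
have i0 : 0 < (2 ^+ n)^-1 :> R by rewrite invr_gt0.
have [d0|/ltW d0] := leP 0 delta.
  apply: (params_between p p'); rewrite lerDl mulr_ge0 ?(ltW i0)//= lerD2l.
  by rewrite ler_piMr.
apply: (params_between p' p); rewrite gerDl mulr_le0_ge0 ?(ltW i0)//= lerD2l.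
by rewrite ler_niMr ?andbT.
Qed.

Lemma memberT_cst theta (c : R) :
  (\int[member F theta]_x c%:E = c%:E)%E.
Proof. by have := expectation_cst (member F theta) c; rewrite unlock. Qed.

Lemma integrable_cst_member theta (c : R) :
  (member F theta).-integrable setT (fun=> c%:E).
Proof. exact: finite_measure_integrable_cst. Qed.

(** The integrals of [dexp (delta * x) n] are [2^n * (expR (u n) - 1)], which tends to [delta * l]
    since [u n] is an increment of [b]; the integrands decrease to [delta * x]. The increments all
    have the sign of [delta], so [theta] may be an endpoint of [params]. *)
Lemma member_id theta delta l : params F theta -> params F (theta + delta) ->
  delta != 0 -> is_derive_within (params F) b theta l ->
  (member F theta).-integrable setT (EFin \o (id : R -> R)) /\
  (\int[member F theta]_x x%:E = l%:E)%E.
Proof.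
move=> pt pt' d0 dl.
pose u n := b (theta + delta / 2 ^+ n) - b theta.
pose A_ n := 2 ^+ n * (expR (u n) - 1).
have pn n := params_div2Xn n pt pt'.
have dn0 n : delta / 2 ^+ n != 0 by rewrite mulf_neq0// invr_eq0 expf_neq0.
have cvq : u n / (delta / 2 ^+ n) @[n --> \oo] --> l.
  have wE n : theta + delta / 2 ^+ n - theta = delta / 2 ^+ n.
    by rewrite addrAC subrr add0r.
  have := is_derive_within_cvg (u := fun n => theta + delta / 2 ^+ n) dl pn.
  have -> : (fun n => (b (theta + delta / 2 ^+ n) - b theta) /
      (theta + delta / 2 ^+ n - theta)) = (fun n => u n / (delta / 2 ^+ n)).
    by apply/funext => n; rewrite wE.
  apply=> [n|]; first by rewrite -subr_eq0 wE.
  rewrite -[X in _ --> X](addr0 theta); apply: cvgD; first exact: cvg_cst.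
  exact: cvg_div2Xn.
have uE n : u n = u n / (delta / 2 ^+ n) * (delta / 2 ^+ n) by rewrite divfK.
have cvu : u n @[n --> \oo] --> (0 : R).
  rewrite (funext uE) -(mulr0 l); apply: cvgM => //.
  exact: cvg_div2Xn.
have cv2u : 2 ^+ n * u n @[n --> \oo] --> delta * l.
  have -> : (fun n => 2 ^+ n * u n) = (fun n => delta * (u n / (delta / 2 ^+ n))).
    by apply/funext => n; rewrite invf_div mulrA mulrAC mulrCA divff// mulr1 mulrC.
  by apply: cvgM => //; exact: cvg_cst.
have cvA : A_ n @[n --> \oo] --> delta * l.
  apply: (@squeeze_cvgr _ _ _ _ (fun n => 2 ^+ n * u n)
    (fun n => (2 ^+ n * u n) * expR (u n))) => //.
  - apply: nearW => n; rewrite /A_ -mulrA !ler_pM2l ?exprn_gt0//.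
    by rewrite expRB1_le andbT; have := expR_ge1Dx (u n); lra.
  - rewrite -[X in _ --> X]mulr1; apply: cvgM => //.
    have := @continuous_expR R 0; rewrite /continuous_at expR0; apply: cvg_trans.
    exact: (cvg_comp _ _ cvu).
have [lb Alb] : exists lb, forall n, lb <= A_ n.
  have /cvg_seq_bounded : cvgn A_ by apply/cvg_ex; exists (delta * l).
  move=> [M [_ /(_ (M + 1))]]; rewrite ltrDl ltr01 => /(_ isT) H.
  exists (- (M + 1)) => n; have := H n I => /=.
  by rewrite ler_norml => /andP[].
have [n|n|x|x|A [intA AE _ AA]] := nonincreasing_cvg_integral (mu := member F theta)
  (f_ := fun n x => dexp (delta * x) n) (f := fun x => delta * x) (A_ := A_) _ _ _ _ Alb.
- rewrite /dexp /comp.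
  under eq_fun do rewrite EFinM EFinB mulrAC.
  apply: integrableZl => //; apply: integrableB => //.
    exact: integrable_member_mgf.
  exact: integrable_cst_member.
- rewrite /dexp.
  under eq_integral do rewrite EFinM EFinB mulrAC.
  have i1 := integrable_member_mgf pt (pn n).
  have i2 := integrable_cst_member theta 1.
  rewrite integralZl//; last exact: integrableB.
  by rewrite integralB// member_mgf// memberT_cst.
- exact: dexp_nincr.
- exact: cvg_dexp.
have AdE : A = delta * l.
  exact: (cvg_unique _ AA cvA).
have idE : EFin \o id = fun x : R => (delta^-1%:E * (delta * x)%:E)%E.
  by apply/funext => x /=; rewrite -EFinM mulKf.
have iid : (member F theta).-integrable setT (EFin \o (id : R -> R)).
  by rewrite idE; exact: integrableZl.
split => //.
move: AE; under eq_integral do rewrite EFinM.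
rewrite integralZl//= AdE.
have fin : (\int[member F theta]_x x%:E)%E \is a fin_num.
  exact: (integrable_fin_num measurableT iid).
by rewrite -(fineK fin) -EFinM => -[/(mulfI d0) ->].
Qed.

End exp_family_integrals.

(** [1 + z <= expR z] at both exponents; the two terms in [d * m] cancel, so centering at the mean
    leaves the second difference unchanged. *)
Lemma expR_pair_ge {R : realType} (x u v w d m : R) : x <= u + v - 2 * w ->
  x <= expR (u - w - d * m) + expR (v - w - - d * m) - 2.
Proof.
have := expR_ge1Dx (u - w - d * m); have := expR_ge1Dx (v - w - - d * m).
rewrite mulNr; lra.
Qed.

Section exp_family_variance.
Context {R : realType} (F : exp_family R).
Local Notation b := (log_partition (base F)).

Lemma integrable_centered_mgf theta delta m :
  params F theta -> params F (theta + delta) ->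
  (member F theta).-integrable setT (fun x : R => (expR (delta * (x - m)))%:E) /\
  (\int[member F theta]_x (expR (delta * (x - m)))%:E =
   (expR (b (theta + delta) - b theta - delta * m))%:E)%E.
Proof.
move=> pt pt'; have i1 := integrable_member_mgf pt pt'.
have e : (fun x : R => (expR (delta * (x - m)))%:E) =
    (fun x => ((expR (- (delta * m)))%:E * (expR (delta * x))%:E)%E).
  apply/funext => x; rewrite -EFinM -expRD; congr (expR _)%:E; ring.
rewrite e; split; first exact: integrableZl.
by rewrite integralZl// member_mgf// -EFinM -expRD addrC.
Qed.

(* [E (d2exp (delta * (X - m)) n)] decreases to [delta^2 * V], and the second
   differences of [b] bound it from below. *)
Lemma member_variance_ge (b1 : R -> R) theta l r : 0 < r ->
  (forall y, theta - r < y < theta + r -> params F y) ->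
  (forall y, theta - r < y < theta + r -> is_derive_within (params F) b y (b1 y)) ->
  is_derive_within (params F) b1 theta l ->
  l <= fine 'V_(member F theta)[id]%E.
Proof.
move=> r0 pr b1D b1l; apply/ler_addgt0Pr => e e0.
have [r' r'0 hr'] := second_difference_ge e0 r0 pr b1D b1l.
have pt : params F theta by apply: pr; lra.
pose delta := r' / 2.
have d0 : 0 < delta by rewrite divr_gt0.
have dr' : delta < r' by rewrite /delta; lra.
set m := fine ('E_(member F theta)[id])%E.
have dn n : 0 < delta / 2 ^+ n < r'.
  rewrite divr_gt0 ?exprn_gt0//= (le_lt_trans _ dr')//.
  by rewrite ler_pdivrMr ?exprn_gt0// ler_peMr ?(ltW d0)// exprn_ege1 ?ler1n.
pose p n := b (theta + delta / 2 ^+ n) - b theta - delta / 2 ^+ n * m.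
pose q n := b (theta + - (delta / 2 ^+ n)) - b theta - (- (delta / 2 ^+ n)) * m.
pose A_ n := 4 ^+ n * (expR (p n) + expR (q n) - 2).
have four n : (4 : R) ^+ n = 2 ^+ n * 2 ^+ n.
  by rewrite -exprMn -natrM.
have Alb n : (l - e) * delta ^+ 2 <= A_ n.
  have [_ [_ h]] := hr' _ (dn n).
  have h2 : (l - e) * (delta / 2 ^+ n) ^+ 2 <= expR (p n) + expR (q n) - 2.
    exact: expR_pair_ge h.
  rewrite /A_ -ler_pdivrMl ?exprn_gt0//; apply: le_trans h2.
  by rewrite le_eqVlt; apply/orP; left; apply/eqP; rewrite four; field; rewrite expf_neq0.
have i1 n := @integrable_centered_mgf theta (delta / 2 ^+ n) m pt (hr' _ (dn n)).1.
have i2 n := @integrable_centered_mgf theta (- (delta / 2 ^+ n)) m pt (hr' _ (dn n)).2.1.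
have dE n x : d2exp (delta * (x - m)) n = 4 ^+ n *
   (expR (delta / 2 ^+ n * (x - m)) + expR (- (delta / 2 ^+ n) * (x - m)) - 2).
  rewrite /d2exp; congr (_ * (expR _ + expR _ - _)); ring.
have [n|n|x|x|A [intA AE Ale _]] := nonincreasing_cvg_integral (mu := member F theta)
  (f_ := fun n x => d2exp (delta * (x - m)) n)
  (f := fun x => (delta * (x - m)) ^+ 2) (A_ := A_) _ _ _ _ Alb.
- rewrite /comp; under eq_fun do rewrite dE EFinM EFinB EFinD.
  apply: integrableZl => //; apply: integrableB => //.
    by apply: integrableD => //; [exact: (i1 n).1|exact: (i2 n).1].
  exact: integrable_cst_member.
- under eq_integral do rewrite dE EFinM EFinB EFinD.
  have i3 := integrable_cst_member F theta 2.
  have [j1 k1] := i1 n; have [j2 k2] := i2 n.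
  have j12 := integrableD measurableT j1 j2.
  rewrite integralZl//; last exact: integrableB.
  rewrite integralB// integralD// k1 k2 memberT_cst.
  by rewrite -!EFinD -EFinM.
- exact: d2exp_nincr.
- exact: cvg_d2exp.
have VE : ('V_(member F theta)[id] = (A / delta ^+ 2)%:E)%E.
  rewrite /variance unlock unlock -/m.
  have -> : (A / delta ^+ 2)%:E = ((delta ^- 2)%:E * A%:E)%E by rewrite -EFinM mulrC.
  rewrite -AE -integralZl//; apply: eq_integral => x _; rewrite -EFinM; congr (_%:E).
  have -> : m = fine (\int[member F theta]_w w%:E)%E by rewrite /m unlock.
  by rewrite (exprMn 2 delta) mulKf ?sqrf_eq0 ?gt_eqF// expr2.
by rewrite VE/= -lerBlDr ler_pdivlMr// exprn_gt0.
Qed.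

End exp_family_variance.

(** * Divergence between two members *)

Section exp_family_kl.
Context {R : realType} (F : exp_family R).
Local Notation b := (log_partition (base F)).

(** The exponential tilt and the Radon-Nikodym derivative have the same integrals over measurable
    sets, hence agree almost everywhere for [nu'], and by domination for [nu]. The logarithm of the
    tilt is affine, so only the mean of [nu] enters. *)
Lemma kl_divergence_member theta theta' m : params F theta -> params F theta' ->
  (member F theta).-integrable setT (EFin \o (id : R -> R)) ->
  (\int[member F theta]_x x%:E = m%:E)%E ->
  kl_divergence (member F theta) (member F theta') =
    ((theta - theta') * m - b theta + b theta')%:E.
Proof.
move=> pt pt' iid mE; set nu := member F theta; set nu' := member F theta'.
pose g (x : R) := expR ((theta - theta') * x - (b theta - b theta')).
have mg : measurable_fun setT g by exact: measurable_expR_affine.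
have nuE A : measurable A -> (nu A = \int[nu']_(x in A) (g x)%:E)%E.
  exact: member_density.
have dom : charge_of_finite_measure nu `<< nu'.
  apply/null_content_dominatesP => A mA A0.
  rewrite /charge_of_finite_measure [LHS]nuE//.
  apply: null_set_integral => //.
  by apply/measurable_EFinP; exact: measurable_funTS.
have ig : nu'.-integrable setT (EFin \o g).
  apply/integrableP; split; first exact/measurable_EFinP.
  rewrite (_ : integral _ _ _ = 1%E) ?ltry//.
  rewrite -(probability_setT nu) [RHS]nuE//; apply: eq_integral => x _ /=.
  by rewrite ger0_norm ?expR_ge0.
have mRN : measurable_fun setT (Radon_Nikodym (charge_of_finite_measure nu) nu').
  by [].
have aeq : ae_eq nu' setT (EFin \o g) (Radon_Nikodym (charge_of_finite_measure nu) nu').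
  apply: integral_ae_eq => // E _ mE'.
  rewrite -(Radon_Nikodym_integral dom mE').
  by rewrite /charge_of_finite_measure/= nuE.
have {}aeq : ae_eq nu setT (EFin \o g) (Radon_Nikodym (charge_of_finite_measure nu) nu').
  exact: (null_dominates_ae_eq measurableT _ aeq).
rewrite /kl_divergence -/nu -/nu'.
transitivity (\int[nu]_x ((theta - theta') * x - (b theta - b theta'))%:E)%E.
  apply: ae_eq_integral => //.
  - apply/measurable_EFinP; apply: measurableT_comp => //.
    by apply: measurableT_comp.
  - apply/measurable_EFinP; exact: measurable_funB.
  - apply: filterS aeq => x h _; rewrite -(h I) /=.
    by rewrite expRK.
under eq_integral do rewrite EFinB EFinM.
rewrite integralB//; last 2 first.
- exact: integrableZl.
- exact: integrable_cst_member.
rewrite integralZl// mE memberT_cst -EFinM -EFinB; congr (_%:E); ring.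
Qed.

End exp_family_kl.

Lemma eq_is_derive_within {R : realType} (D : set R) (f g : R -> R) (x l : R) :
  D x -> (forall y, D y -> f y = g y) ->
  is_derive_within D f x l -> is_derive_within D g x l.
Proof.
move=> Dx fg /is_derive_withinP h; apply/is_derive_withinP => e /h[r r0 rh].
by exists r => // y Dy yx yr; rewrite -!fg//; exact: rh.
Qed.

(** * Geometry of the Kullback-Leibler divergence *)

(** Bregman divergence of the log-partition function, whose derivative is [mean]. Working with
    natural parameters keeps [param_of] and Radon-Nikodym derivatives out of the geometry. *)
Definition kl_params {R : realType} (F : exp_family R) (s t : R) : R :=
  (s - t) * mean F s - log_partition (base F) s + log_partition (base F) t.

Section regular_family.
Context {R : realType} (F : exp_family R).
Hypothesis regF : regular_log_partition F.
(** On a one-point [params] the punctured filter in [is_derive_within] is trivial and every number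
    is a derivative, so nothing could be learnt about the mean. A positive gap between two arms
    provides the two parameters. *)
Hypothesis params2 : exists s t, [/\ params F s, params F t & s < t].
Local Notation b := (log_partition (base F)).
Local Notation m := (mean F).
Local Notation kl := (kl_params F).

Lemma mean_integral theta l : params F theta ->
  is_derive_within (params F) b theta l ->
  [/\ (member F theta).-integrable setT (EFin \o (id : R -> R)),
    (\int[member F theta]_x x%:E = (m theta)%:E)%E & m theta = l].
Proof.
move=> pt dl.
have [delta pd d0] : exists2 delta, params F (theta + delta) & delta != 0.
  have [s [t [ps pt' st]]] := params2.
  have [e|ne] := eqVneq theta s.
    exists (t - theta); first by rewrite addrC subrK.
    by rewrite subr_eq0 e gt_eqF.
  exists (s - theta); first by rewrite addrC subrK.
  by rewrite subr_eq0 eq_sym.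
have [iid E] := member_id pt pd d0 dl.
have mb : m theta = l by rewrite /mean unlock E.
by rewrite mb.
Qed.

Lemma mean_derive : exists b2 : R -> R,
  [/\ forall theta, params F theta -> is_derive_within (params F) b theta (m theta),
      forall theta, params F theta -> is_derive_within (params F) m theta (b2 theta) &
      forall theta, params F theta -> 0 < b2 theta].
Proof.
have [b1 [b2 [db db1 _ b20]]] := regF.
have mb theta : params F theta -> m theta = b1 theta.
  by move=> pt; have [] := mean_integral pt (db _ pt).
exists b2; split => // theta pt; first by rewrite mb//; exact: db.
by apply: (eq_is_derive_within pt _ (db1 _ pt)) => y py; rewrite mb.
Qed.

Lemma b_continuous : {within params F, continuous b}.
Proof. by have [b2 [db _ _]] := mean_derive; exact: is_derive_within_continuous db. Qed.

Lemma mean_continuous : {within params F, continuous m}.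
Proof. by have [b2 [_ dm _]] := mean_derive; exact: is_derive_within_continuous dm. Qed.

Lemma params_segment s t : params F s -> params F t -> `[s, t] `<=` params F.
Proof. by move=> ps pt u; rewrite /= in_itv/=; exact: params_between. Qed.

Lemma mean_lt s t : params F s -> params F t -> s < t -> m s < m t.
Proof.
move=> ps pt st; have [b2 [_ dm b20]] := mean_derive.
have sub u : s < u < t -> params F u.
  by move=> /andP[su ut]; apply: (params_between ps pt); rewrite !ltW.
apply: (gtr0_is_derive_lt st) => [u stu|u stu|].
- exact: (is_derive_within_is_derive (dm _ (sub _ stu)) sub).
- exact: b20 (sub _ stu).
- exact: continuous_subspaceW (params_segment ps pt) mean_continuous.
Qed.

Lemma mean_le s t : params F s -> params F t -> s <= t -> m s <= m t.
Proof.
by move=> ps pt; rewrite le_eqVlt => /predU1P[->//|/(mean_lt ps pt)/ltW].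
Qed.

Lemma mean_lt_inv s t : params F s -> params F t -> m s < m t -> s < t.
Proof. by move=> ps pt; apply: contraTT; rewrite -!leNgt; exact: mean_le. Qed.

Lemma mean_le_inv s t : params F s -> params F t -> m s <= m t -> s <= t.
Proof. by move=> ps pt; apply: contraTT; rewrite -!ltNge; exact: mean_lt. Qed.

Lemma param_ofK theta : params F theta -> param_of F (m theta) = theta.
Proof.
move=> pt; rewrite /param_of.
case: xgetP => [t _ [pt' e]|/(_ theta)]; last by case.
by apply/eqP; rewrite eq_le; apply/andP; split; apply: mean_le_inv; rewrite // e.
Qed.

Lemma KL_kl s t : params F s -> params F t -> KL F (m s) (m t) = kl s t.
Proof.
move=> ps pt; rewrite /KL !param_ofK//; have [b2 [db _ _]] := mean_derive.
have [iid E _] := mean_integral ps (db _ ps).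
by rewrite (kl_divergence_member ps pt iid E).
Qed.

(** Three-point identity of Bregman divergences. As the mean is increasing, the last term is
    nonnegative when [u] lies between [s] and [t], which gives superadditivity. *)
Lemma kl_split s u t :
  kl s t = kl s u + kl u t + (u - t) * (m s - m u).
Proof.
rewrite /kl_params; move: (m s) (m u) (b s) (b u) (b t) => *; ring.
Qed.

Lemma mean_IVT s t v : params F s -> params F t -> s <= t ->
  m s <= v <= m t -> exists2 u, s <= u <= t & m u = v.
Proof.
move=> ps pt st v12.
have cm := continuous_subspaceW (params_segment ps pt) mean_continuous.
have mst := mean_le ps pt st.
have [|u] := IVT st cm (v := v); first by rewrite (min_idPl mst) (max_idPr mst).
by rewrite in_itv/= => ust muv; exists u.
Qed.

Lemma kl_quadratic (W s t : R) : params F s -> params F t -> 0 < W ->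
  (forall u, Num.min s t < u < Num.max s t -> variance_fun F (m u) <= W) ->
  (m s - m t) ^+ 2 / (2 * W) <= kl s t.
Proof.
move=> ps pt W0 VW; have [b2 [db dm b20]] := mean_derive.
rewrite ler_pdivrMr ?mulr_gt0//.
have cont x y : params F x -> params F y -> {within `[x, y], continuous b} /\
    {within `[x, y], continuous m}.
  move=> px py; split.
    exact: continuous_subspaceW (params_segment px py) b_continuous.
  exact: continuous_subspaceW (params_segment px py) mean_continuous.
(* [b] has second derivative [b2 <= V <= W] inside the segment, hence
   [W * kl s u - (m u - m s)^2 / 2] is monotone in [u] on both sides of [s]. *)
pose G u := 2 * W * (b u - b s - (u - s) * m s) - (m u - m s) * (m u - m s).
pose G' u := 2 * (m u - m s) * (W - b2 u).
have GD x y u : params F x -> params F y -> x < u < y ->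
    is_derive u (1 : R) G (G' u).
  move=> px py xuy.
  have sub v : x < v < y -> params F v.
    by move=> /andP[xv vy]; apply: (params_between px py); rewrite !ltW.
  have D1 := is_derive_within_is_derive (db _ (sub _ xuy)) sub xuy.
  have D2 := is_derive_within_is_derive (dm _ (sub _ xuy)) sub xuy.
  have D0 : is_derive u (1 : R) (fun u => u - s) 1.
    by have := is_deriveB (is_derive_id u 1) (is_derive_cst s u 1); rewrite subr0.
  have D3 : is_derive u (1 : R) (fun u => (u - s) * m s) (m s).
    have := @is_deriveM R R _ (cst (m s)) u 1 _ 0 D0 _.
    rewrite scaler0 add0r (_ : cst (m s) u *: 1 = m s); first exact.
    exact: mulr1.
  have D4 : is_derive u (1 : R) (fun u => m u - m s) (b2 u).
    by have := is_deriveB D2 (is_derive_cst (m s) u 1); rewrite subr0.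
  have D5 : is_derive u (1 : R) (fun u => b u - b s - (u - s) * m s) (m u - m s).
    by have := is_deriveB (is_deriveB D1 (is_derive_cst (b s) u 1)) D3; rewrite subr0.
  have D6 := is_deriveB (is_deriveZ (2 * W) D5) (is_deriveM D4 D4).
  apply: (is_derive_eq D6).
  rewrite /G' /GRing.scale/=; clear; move: (m s) (m u) (b2 u) => *; ring.
have Gc x y : params F x -> params F y -> {within `[x, y], continuous G}.
  move=> px py; have [cb cm] := cont _ _ px py.
  move=> u; apply: cvgB.
    apply: cvgM; first exact: cvg_cst.
    apply: cvgB; first by apply: cvgB; [exact: cb|exact: cvg_cst].
    apply: cvgM; last exact: cvg_cst.
    have : {within `[x, y], continuous (fun u : R => u - s)}.
      apply: continuous_subspaceT => v.
      by apply: cvgB; [exact: cvg_id|exact: cvg_cst].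
    exact.
  by apply: cvgM; apply: cvgB; [exact: cm|exact: cvg_cst|exact: cm|exact: cvg_cst].
(* One inequality between [b2] and the variance suffices. The point [u] is interior to the segment,
   as the symmetric second differences require. *)
have VE x y u : params F x -> params F y -> x < u < y -> b2 u <= variance_fun F (m u).
  move=> px py /andP[xu uy].
  have pu : params F u by apply: (params_between px py); rewrite !ltW.
  rewrite /variance_fun param_ofK//.
  have sub v : u - Num.min (u - x) (y - u) < v < u + Num.min (u - x) (y - u) -> params F v.
    move=> /andP[]; have [h|h] := leP (u - x) (y - u) => h1 h2;
    by apply: (params_between px py); apply/andP; split; lra.
  apply: (member_variance_ge (b1 := m) (r := Num.min (u - x) (y - u))) => //.
  - by rewrite lt_min !subr_gt0 xu.
  - by move=> v /sub; exact: db.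
  - exact: dm.
have G0 : G s = 0 by rewrite /G !subrr; ring.
suff : G s <= G t by rewrite G0 /G /kl_params; clear; move: (m s) (m t) (b s) (b t) => *; lra.
have [st|ts|->//] := ltgtP s t.
- apply: (ger0_is_derive_le (ltW st) _ _ (Gc _ _ ps pt) (f' := G')) => u sut.
    exact: GD sut.
  have /andP[su ut] := sut.
  have pu : params F u by apply: (params_between ps pt); rewrite !ltW.
  rewrite /G' !mulr_ge0// subr_ge0; first by rewrite mean_le// ltW.
  rewrite (le_trans (VE _ _ _ ps pt sut))// VW//.
  by rewrite (min_idPl _) ?(max_idPr _) ?ltW.
- rewrite -lerN2.
  apply: (@ger0_is_derive_le _ (fun u => - G u) (fun u => - G' u) _ _ (ltW ts)) => [u tus|u tus|].
  + by apply: is_deriveN; exact: GD tus.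
  + have /andP[tu us] := tus.
    have pu : params F u by apply: (params_between pt ps); rewrite !ltW.
    rewrite /G' -mulNr mulr_ge0//.
      by rewrite -mulrN mulr_ge0// oppr_ge0 subr_le0 mean_le// ltW.
    rewrite subr_ge0 (le_trans (VE _ _ _ pt ps tus))// VW//.
    by rewrite (min_idPr _) ?(max_idPl _) ?ltW.
  + by move=> u; apply: cvgN; exact: (Gc _ _ pt ps).
Qed.

(** By the mean value theorem [b t - b s = m u * (t - s)] with [u] strictly between, and [m u - m s]
    has the sign of [t - s]. *)
Lemma kl_gt0 s t : params F s -> params F t -> s != t -> 0 < kl s t.
Proof.
move=> ps pt; have [b2 [db _ _]] := mean_derive.
have sub x y u : params F x -> params F y -> x < u < y -> params F u.
  by move=> px py /andP[xu uy]; apply: (params_between px py); rewrite !ltW.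
have cb x y : params F x -> params F y -> {within `[x, y], continuous b}.
  by move=> px py; exact: continuous_subspaceW (params_segment px py) b_continuous.
have MVTb x y : params F x -> params F y -> x < y ->
    exists u, [/\ params F u, x < u, u < y & b y - b x = m u * (y - x)].
  move=> px py xy.
  have bD u : u \in `]x, y[ -> is_derive u (1 : R) b (m u).
    rewrite in_itv/= => xuy.
    exact: (is_derive_within_is_derive (db _ (sub _ _ _ px py xuy))
      (fun v => @sub x y v px py) xuy).
  have [u] := MVT xy bD (cb _ _ px py); rewrite in_itv/= => xuy e.
  by exists u; have /andP[? ?] := xuy; split => //; exact: (sub _ _ _ px py xuy).
have [st _|ts _|//] := ltgtP s t.
- have [u [pu su _ e]] := MVTb _ _ ps pt st.
  have : 0 < (m u - m s) * (t - s) by rewrite mulr_gt0 ?subr_gt0// mean_lt.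
  rewrite /kl_params; move: (m s) (m u) (b s) (b t) e => *; lra.
- have [u [pu _ us e]] := MVTb _ _ pt ps ts.
  have : 0 < (m s - m u) * (s - t) by rewrite mulr_gt0 ?subr_gt0// mean_lt.
  rewrite /kl_params; move: (m s) (m u) (b s) (b t) e => *; lra.
Qed.

Lemma kl_refl s : kl s s = 0.
Proof. by rewrite /kl_params subrr mul0r sub0r addNr. Qed.

Lemma kl_ge0 s t : params F s -> params F t -> 0 <= kl s t.
Proof.
move=> ps pt; have [->|st] := eqVneq s t; first by rewrite kl_refl.
by rewrite ltW// kl_gt0.
Qed.

Lemma kl_superadditive s u t : params F s -> params F u -> params F t ->
  (s <= u <= t) || (t <= u <= s) -> kl s u + kl u t <= kl s t.
Proof.
move=> ps pu pt h; rewrite (kl_split s u t) lerDl.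
case/orP: h => /andP[h1 h2].
  by rewrite mulr_le0// subr_le0// mean_le.
by rewrite mulr_ge0// subr_ge0// mean_le.
Qed.

Lemma kl_anti_l s s' t : params F s -> params F s' -> params F t ->
  s <= s' -> s' <= t -> kl s' t <= kl s t.
Proof.
move=> ps ps' pt ss' s't; apply: le_trans (kl_superadditive ps ps' pt _).
  by rewrite lerDr kl_ge0.
by rewrite ss' s't.
Qed.

Lemma kl_mono_r s t t' : params F s -> params F t -> params F t' ->
  s <= t -> t <= t' -> kl s t <= kl s t'.
Proof.
move=> ps pt pt' st tt'; apply: le_trans (kl_superadditive ps pt pt' _).
  by rewrite lerDl kl_ge0.
by rewrite st tt'.
Qed.

Lemma kl_IVT s t v : params F s -> params F t -> s <= t -> 0 <= v <= kl s t ->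
  exists2 u, s <= u <= t & kl u t = v.
Proof.
move=> ps pt st v12.
have cb := continuous_subspaceW (params_segment ps pt) b_continuous.
have cm := continuous_subspaceW (params_segment ps pt) mean_continuous.
have cid : {within `[s, t], continuous (fun u : R => u - t)}.
  apply: continuous_subspaceT => x.
  by apply: cvgB; [exact: cvg_id|exact: cvg_cst].
have ck : {within `[s, t], continuous (fun u => kl u t)}.
  move=> u; apply: cvgD; last exact: cvg_cst.
  apply: cvgB; last exact: cb.
  by apply: cvgM; [exact: cid|exact: cm].
have k0 := kl_refl t.
have kst := kl_ge0 ps pt.
have [|u] := IVT st ck (v := v); first by rewrite k0 (min_idPr kst) (max_idPl kst).
by rewrite in_itv/= => ust e; exists u.
Qed.

End regular_family.

(** * Likelihood-ratio martingale *)

Section conditional_law.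
Context d (Om : measurableType d) (R : realType) (P : probability Om R).
Variable G : set (set Om).
Hypothesis GM : G `<=` measurable.
Variables (X : Om -> R) (nu : probability R R) (J : set Om).
Hypothesis mX : measurable_fun setT X.
Hypothesis GJ : <<s G >> J.
Hypothesis condX : forall B H, measurable B -> <<s G >> H -> H `<=` J ->
  P (X @^-1` B `&` H) = (nu B * P H)%E.
Variable g : R -> R.
Hypothesis mg : measurable_fun setT g.
Hypothesis g0 : forall x, 0 <= g x.
Hypothesis g1 : (\int[nu]_x (g x)%:E = 1)%E.

Lemma sigma_algebra_measurable A : <<s G >> A -> measurable A.
Proof.
by move=> GA; apply: (GA measurable); split => //; exact: sigma_algebra_measurable.
Qed.

Lemma integral_indicE (h : Om -> R) (A : set Om) : measurable A ->
  (\int[P]_(w in A) (h w)%:E = \int[P]_w ((h w)%:E * (\1_A w)%:E))%E.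
Proof. by move=> mA; rewrite integral_mkcond epatch_indic. Qed.

(** By [condX], the image under [X] of [P] restricted to [H] is [nu] scaled by [P H], and [g] has
    integral one against [nu]. *)
Lemma integral_condX H : <<s G >> H -> H `<=` J ->
  (\int[P]_(w in H) (g (X w))%:E = P H)%E.
Proof.
move=> GH HJ; have mH := sigma_algebra_measurable GH.
have PHfin : P H \is a fin_num by exact: fin_num_measure.
pose k : {nonneg R} := NngNum (fine_ge0 (measure_ge0 P H)).
have kE A : measurable A ->
    mscale k nu A = (\int[P]_(w in X @^-1` A) (\1_H w)%:E)%E.
  move=> mA; rewrite /mscale/= fineK// integral_indic//; last first.
    by rewrite -[X in measurable X]setTI; exact: mX.
  by rewrite muleC -condX// setIC.
have m1H : measurable_fun setT (\1_H : Om -> R) by exact: measurable_indic.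
have mEg : measurable_fun setT (EFin \o g) by exact/measurable_EFinP.
have Eg0 x : (0 <= (EFin \o g) x)%E by rewrite lee_fin.
rewrite integral_indicE//.
rewrite -(@ge0_integral_pushforward_density _ _ _ _ _ P (mscale k nu) X \1_H mX m1H
  (fun w => ler0n _ _) kE (EFin \o g) mEg Eg0).
rewrite ge0_integral_mscale//.
by rewrite g1 mule1 /= fineK.
Qed.

(** The measure [P] restricted to [J] and to the sigma-algebra generated by [G] has two densities:
    [\1_J] and, by [integral_condX], [g (X w) * \1_J w]. The two sides integrate [Z] with one
    density each. *)
Lemma integral_mul_condX (Z : g_sigma_algebraType G -> R) :
  measurable_fun setT Z -> (forall w, 0 <= Z w) ->
  (\int[P]_(w in J) (Z w * g (X w))%:E = \int[P]_(w in J) (Z w)%:E)%E.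
Proof.
move=> mZ Z0; have mJ := sigma_algebra_measurable GJ.
(* The identity onto a coarser sigma-algebra is measurable; the image under it is the restriction of
   the measure to that sigma-algebra. *)
have mid : measurable_fun setT (id : Om -> g_sigma_algebraType G).
  by move=> _ A GA; rewrite setTI; exact: sigma_algebra_measurable.
pose nuJ0 : {measure set (g_sigma_algebraType G) -> \bar R} :=
  pushforward (mrestr P mJ) (id : Om -> g_sigma_algebraType G).
pose nuJ := nuJ0 mid.
have nuJE (A : set (g_sigma_algebraType G)) : measurable A -> nuJ A = P (A `&` J) by [].
have m1J : measurable_fun setT (\1_J : Om -> R) by exact: measurable_indic.
have mgX : measurable_fun setT (fun w => g (X w)) by exact: measurableT_comp.
have mEZ : measurable_fun setT (EFin \o Z) by exact/measurable_EFinP.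
have E1 : (\int[nuJ]_w (Z w)%:E = \int[P]_w ((Z w)%:E * (\1_J w)%:E))%E.
  apply: (@ge0_integral_pushforward_density _ _ _ _ _ P nuJ id \1_J mid) => // A mA.
  rewrite nuJE// integral_indic//; first by rewrite setIC.
  exact: sigma_algebra_measurable.
have E2 : (\int[nuJ]_w (Z w)%:E = \int[P]_w ((Z w)%:E * (g (X w) * \1_J w)%:E))%E.
  apply: (@ge0_integral_pushforward_density _ _ _ _ _ P nuJ id
    (fun w => g (X w) * \1_J w) mid) => //.
  - exact: measurable_funM.
  - by move=> w; rewrite mulr_ge0.
  - move=> A mA; rewrite nuJE//.
    have mA' : measurable (A : set Om) by exact: sigma_algebra_measurable.
    rewrite -(@integral_condX (A `&` J))//; last first.
      exact: (@measurableI _ (g_sigma_algebraType G)).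
    rewrite integral_mkcondr; apply: eq_integral => w _.
    by rewrite epatch_indic EFinM.
rewrite (integral_indicE (fun w => Z w * g (X w)) mJ) (integral_indicE Z mJ).
rewrite -E1 E2; apply: eq_integral => w _.
by rewrite -!EFinM mulrA.
Qed.

End conditional_law.

Section bandit_martingale.
Context (R : realType) (F : exp_family R) (K : nat).
Context (d : measure_display) (Om : measurableType d) (P : probability Om R).
Variables (I : nat -> Om -> 'I_K) (r : nat -> Om -> R).
Variables (nu : 'I_K -> probability R R) (T : nat).
Hypothesis run : exp_kl_ms_run F I r P nu T.

Definition arm_events (t : nat) : set (set Om) :=
  past_events I r t `|` [set A | exists a, A = I t @^-1` [set a]].

Lemma past_events_measurable t : (t <= T.+1)%N -> past_events I r t `<=` measurable.
Proof.
move=> tT A [i /andP[i1 it]].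
have iT : (1 <= i <= T)%N by rewrite i1 -ltnS (leq_trans it).
move=> [[a ->]|[B mB ->]]; first exact: run_measI run _ _ iT.
by rewrite -[X in measurable X]setTI; exact: run_measr run _ iT _ _ _.
Qed.

Lemma arm_events_measurable t : (1 <= t <= T)%N -> arm_events t `<=` measurable.
Proof.
move=> tT A [|[a ->]]; last exact: run_measI run _ _ tT.
by apply: past_events_measurable; case/andP: tT => _ /leqW.
Qed.

Lemma history_measurable t A : (t <= T.+1)%N -> history I r t A -> measurable A.
Proof. by move=> tT; apply: sigma_algebra_measurable; exact: past_events_measurable. Qed.

Lemma history_arm_measurable t A : (1 <= t <= T)%N -> history_arm I r t A -> measurable A.
Proof. by move=> tT; apply: sigma_algebra_measurable; exact: arm_events_measurable. Qed.

Lemma sub_history_arm t A : history I r t A -> history_arm I r t A.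
Proof. by apply: sub_sigma_algebra2; exact: subsetUl. Qed.

Lemma arm_history i t a : (1 <= i < t)%N -> history I r t (I i @^-1` [set a]).
Proof. by move=> it; apply: sub_sigma_algebra; exists i => //; left; exists a. Qed.

Lemma arm_history_arm t a : history_arm I r t (I t @^-1` [set a]).
Proof. by apply: sub_sigma_algebra; right; exists a. Qed.

Lemma reward_history i t B : (1 <= i < t)%N -> measurable B ->
  history I r t (r i @^-1` B).
Proof. by move=> it mB; apply: sub_sigma_algebra; exists i => //; right; exists B. Qed.

Lemma run_reward_arm t a B H : (1 <= t <= T)%N -> measurable B ->
  history_arm I r t H -> H `<=` I t @^-1` [set a] ->
  P (r t @^-1` B `&` H) = (nu a B * P H)%E.
Proof.
move=> tT mB hH Ha; have mH := history_arm_measurable tT hH.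
have [_ ->//] := run_reward run tT mB.
transitivity (\int[P]_(w in H) (cst (nu a B) w))%E.
  apply: eq_integral => w; rewrite inE => /Ha /= ->.
  by rewrite fineK// fin_num_measure.
by rewrite integral_cst.
Qed.

Variables (a : 'I_K) (g : R -> R).
Hypothesis mg : measurable_fun setT g.
Hypothesis g0 : forall x, 0 <= g x.
Hypothesis g1 : (\int[nu a]_x (g x)%:E = 1)%E.

(** When [g] is the density of another member relative to [nu a], this is the likelihood ratio of
    the rewards received from [a]; it is a martingale because [g] integrates to one. *)
Definition likelihood (t : nat) (w : Om) : R :=
  \prod_(1 <= i < t.+1 | I i w == a) g (r i w).

Lemma likelihood_ge0 t w : 0 <= likelihood t w.
Proof. by rewrite /likelihood; elim/big_ind : _ => // x y; exact: mulr_ge0. Qed.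

Lemma likelihoodS t w : likelihood t.+1 w =
  likelihood t w * (if I t.+1 w == a then g (r t.+1 w) else 1).
Proof.
by rewrite /likelihood big_mkcond [in RHS]big_mkcond big_nat_recr.
Qed.

Lemma measurable_likelihood t : measurable_fun setT
  (likelihood t : g_sigma_algebraType (past_events I r t.+1) -> R).
Proof.
pose Gt := past_events I r t.+1.
suff H n : (n <= t)%N -> measurable_fun setT (likelihood n : g_sigma_algebraType Gt -> R).
  exact: H.
elim: n => [_|n IH nt].
  rewrite (_ : likelihood 0 = cst 1)//.
  by apply/funext => w; rewrite /likelihood big_geq.
rewrite (funext (likelihoodS n)).
apply: (@measurable_funM _ (g_sigma_algebraType Gt)); first by apply: IH; exact: ltnW.
have iT : (1 <= n.+1 < t.+1)%N by [].
apply: measurable_fun_ifT => //.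
  apply: (@measurable_fun_bool _ _ _ _ true); rewrite setTI.
  rewrite (_ : _ @^-1` _ = I n.+1 @^-1` [set a]); first exact: arm_history.
  by apply/seteqP; split => w /= /eqP.
by apply: measurableT_comp => // _ B mB; rewrite setTI; exact: reward_history.
Qed.

Lemma measurable_likelihood_arm t : measurable_fun setT
  (likelihood t : g_sigma_algebraType (arm_events t.+1) -> R).
Proof.
move=> _ B mB; rewrite setTI; apply: sub_history_arm.
by have := @measurable_likelihood t measurableT B mB; rewrite setTI.
Qed.

Lemma measurable_likelihoodT t : (t <= T)%N -> measurable_fun setT (likelihood t).
Proof.
move=> tT _ B mB; rewrite setTI; apply: (@history_measurable t.+1) => //.
by have := @measurable_likelihood t measurableT B mB; rewrite setTI.
Qed.

(** Where [a] is pulled, the new factor has conditional mean one; elsewhere it equals one. The event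
    [A] may involve the arm chosen in round [t.+1], though not its reward, so that conditions on
    [I t.+1] are allowed later. *)
Lemma likelihood_step t A : (1 <= t.+1 <= T)%N -> history_arm I r t.+1 A ->
  (\int[P]_(w in A) (likelihood t.+1 w)%:E = \int[P]_(w in A) (likelihood t w)%:E)%E.
Proof.
move=> tT hA; have mA := history_arm_measurable tT hA.
pose J := I t.+1 @^-1` [set a].
have hJ : history_arm I r t.+1 J by exact: arm_history_arm.
have mJ := history_arm_measurable tT hJ.
have hAJ : history_arm I r t.+1 (A `&` J).
  exact: (@measurableI _ (g_sigma_algebraType (arm_events t.+1))).
have AE : A = (A `&` J) `|` (A `\` J) by rewrite setUIDK.
have AJ : [disjoint (A `&` J) & (A `\` J)] by apply/disj_setPS => w [[_ ?] []].
have mt : measurable_fun setT (likelihood t).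
  by apply: measurable_likelihoodT; case/andP: tT => _ /ltnW.
have mtS : measurable_fun setT (likelihood t.+1).
  by apply: measurable_likelihoodT; case/andP: tT.
have split_int s : measurable_fun setT (likelihood s) ->
    (\int[P]_(w in A) (likelihood s w)%:E =
     \int[P]_(w in A `&` J) (likelihood s w)%:E +
     \int[P]_(w in A `\` J) (likelihood s w)%:E)%E.
  move=> ms; rewrite [in LHS]AE ge0_integral_setU//.
  - exact: measurableI.
  - exact: measurableD.
  - by apply/measurable_EFinP; exact: measurable_funTS.
  - by move=> w _; rewrite lee_fin likelihood_ge0.
rewrite !split_int//; congr (_ + _)%E.
  rewrite -(@integral_mul_condX _ _ _ P (arm_events t.+1)
    (@arm_events_measurable _ tT) (r t.+1) (nu a) (A `&` J) _ hAJ _ g mg g0 g1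
    (likelihood t) (@measurable_likelihood_arm t) (likelihood_ge0 t)).
  - apply: eq_integral => w; rewrite inE => -[_ /= wa].
    by rewrite likelihoodS wa eqxx.
  - exact: run_measr run _ tT.
  - move=> B H mB hH HJ; apply: run_reward_arm => //.
    by move=> w /HJ [].
apply: eq_integral => w; rewrite inE => -[_ /= /eqP wa].
by rewrite likelihoodS (negbTE wa) mulr1.
Qed.

End bandit_martingale.

Lemma max_arm_ge (R : realType) (K : nat) (f : 'I_K -> R) a : f a <= max_arm f.
Proof.
apply: ub_le_sup; last by exists a.
exists (\sum_a `|f a|) => _ [i _ <-].
rewrite (bigD1 i)//= (le_trans (ler_norm _))// lerDl.
by apply: sumr_ge0.
Qed.

Lemma max_arm_attained (R : realType) (K : nat) (f : 'I_K -> R) : (0 < K)%N ->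
  exists a, max_arm f = f a.
Proof.
case: K f => // K f _.
have [i _ fi] := @arg_maxP _ _ _ ord0 xpredT f isT.
exists i; apply/eqP; rewrite eq_le max_arm_ge andbT.
apply: ge_sup; first by exists (f ord0); exists ord0.
by move=> _ [j _ <-]; exact: fi.
Qed.

(** * Chernoff bounds without a union over rounds *)

Section likelihood_bounds.
Context (R : realType) (F : exp_family R) (K : nat).
Context (d : measure_display) (Om : measurableType d) (P : probability Om R).
Variables (I : nat -> Om -> 'I_K) (r : nat -> Om -> R).
Variables (nu : 'I_K -> probability R R) (T : nat).
Hypothesis run : exp_kl_ms_run F I r P nu T.

Lemma sub_history t : (0 < t)%N -> history_arm I r t `<=` history I r t.+1.
Proof.
move=> t0; apply: sub_sigma_algebra2 => A [|[b ->]].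
  by move=> [i /andP[i0 it] h]; exists i => //; rewrite i0 ltnS ltnW.
by exists t; [rewrite t0 ltnS leqnn|left; exists b].
Qed.

Variables (a : 'I_K) (g : R -> R).
Hypothesis mg : measurable_fun setT g.
Hypothesis g0 : forall x, 0 <= g x.
Hypothesis g1 : (\int[nu a]_x (g x)%:E = 1)%E.
Local Notation Z := (likelihood I r a g).

Lemma likelihood0 : Z 0%N = cst 1.
Proof. by apply/funext => w; rewrite /likelihood big_geq. Qed.

Lemma integral_likelihood0 : (\int[P]_w (Z 0%N w)%:E = 1)%E.
Proof.
rewrite likelihood0; have := expectation_cst P (1 : R).
by rewrite unlock.
Qed.

Lemma integral_likelihood t : (t <= T)%N -> (\int[P]_w (Z t w)%:E = 1)%E.
Proof.
elim: t => [_|t IH tT]; first exact: integral_likelihood0.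
rewrite (likelihood_step run mg g0 g1)//; first exact/IH/ltnW.
exact: (@measurableT _ (g_sigma_algebraType (arm_events I r t.+1))).
Qed.

Lemma le_integral_likelihood c t A : (t <= T)%N -> measurable A ->
  (forall w, A w -> expR c <= Z t w) ->
  ((expR c)%:E * P A <= \int[P]_(w in A) (Z t w)%:E)%E.
Proof.
move=> tT mA AZ; rewrite -integral_cst//.
apply: ge0_le_integral => //.
- by move=> w _; rewrite lee_fin expR_ge0.
- apply/measurable_EFinP/measurable_funTS.
  exact: (measurable_likelihoodT run a mg tT).
Qed.

Lemma markov_likelihood c t A : (t <= T)%N -> measurable A ->
  (forall w, A w -> expR c <= Z t w) -> fine (P A) <= expR (- c).
Proof.
move=> tT mA AZ; have mZ := measurable_likelihoodT run a mg tT.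
have : ((expR c)%:E * P A <= 1)%E.
  rewrite (le_trans (le_integral_likelihood tT mA AZ))//.
  rewrite -(integral_likelihood tT); apply: ge0_subset_integral => //.
    exact/measurable_EFinP.
  by move=> w _; rewrite lee_fin likelihood_ge0.
rewrite -(@fineK _ (P A)) ?fin_num_measure// -EFinM lee_fin => h.
by rewrite expRN -[leRHS]mulr1 ler_pdivlMl ?expR_gt0.
Qed.

Section disjoint_events.
Variable A : nat -> set Om.
Hypothesis hA : forall t, (1 <= t <= T)%N -> history_arm I r t (A t).
Hypothesis disjA : forall s t w, (1 <= s < t)%N -> A s w -> ~ A t w.

(** The event that none of [A 1], ..., [A n] has occurred. *)
Fixpoint avoiding (n : nat) : set Om :=
  if n is m.+1 then avoiding m `\` A n else setT.

Let A_avoiding n w : A n.+1 w -> avoiding n w.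
Proof.
move=> Anw; suff H m : (m <= n)%N -> avoiding m w by exact: H.
elim: m => //= m IH mn; split; first exact/IH/ltnW.
by move=> Amw; apply: (disjA _ Amw Anw); rewrite /= ltnS.
Qed.

(** Optional stopping at the first event that occurs: in each round the mass on [avoiding n] either
    is collected on [A n.+1], before the reward of that round, or moves on to time [n.+1] by
    [likelihood_step]. Disjointness makes [A n.+1] a subset of [avoiding n]. *)
Lemma sum_integral_likelihood n : (n <= T)%N ->
  (\sum_(1 <= t < n.+1) \int[P]_(w in A t) (Z t.-1 w)%:E
    + \int[P]_(w in avoiding n) (Z n w)%:E = 1)%E.
Proof.
have hav m : (m <= T)%N -> history I r m.+1 (avoiding m).
  elim: m => [_|m IH mT].
    exact: (@measurableT _ (g_sigma_algebraType (past_events I r 1))).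
  apply: sub_history => //.
  apply: (@measurableD _ (g_sigma_algebraType (arm_events I r m.+1))).
    by apply: sub_history_arm; apply: IH; exact: ltnW.
  exact: hA.
elim: n => [_|n IH nT].
  by rewrite big_geq// add0e integral_likelihood0.
have nT' := ltnW nT.
have mav : measurable (avoiding n).
  by apply: (history_measurable run _ (hav _ nT')).
have mA : measurable (A n.+1) by apply: (history_arm_measurable run _ (hA _)).
rewrite -(IH nT') big_nat_recr//= -addeA; congr (_ + _)%E.
rewrite (likelihood_step run mg g0 g1)//; last first.
  apply: (@measurableD _ (g_sigma_algebraType (arm_events I r n.+1))).
    by apply: sub_history_arm; exact: hav.
  exact: hA.
rewrite -[in RHS](@setDUK _ (A n.+1) (avoiding n)); last exact: A_avoiding.
rewrite ge0_integral_setU//.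
- exact: measurableD.
- apply/measurable_EFinP/measurable_funTS.
  exact: (measurable_likelihoodT run a mg nT').
- by move=> w _; rewrite lee_fin likelihood_ge0.
- by apply/disj_setPS => w [] + [].
Qed.

(** The collected masses sum to at most one, and each is at least [expR c] times the probability of
    its event. *)
Lemma chernoff_disjoint c :
  (forall t w, (1 <= t <= T)%N -> A t w -> expR c <= Z t.-1 w) ->
  \sum_(1 <= t < T.+1) fine (P (A t)) <= expR (- c).
Proof.
move=> AZ; rewrite expRN -[leRHS]mulr1 ler_pdivlMl ?expR_gt0//.
rewrite -lee_fin EFinM -sumEFin -(sum_integral_likelihood (leqnn T)).
apply: (@le_trans _ _ (\sum_(1 <= t < T.+1) (\int[P]_(w in A t) (Z t.-1 w)%:E)))%E.
  rewrite ge0_sume_distrr; last by move=> t _; rewrite lee_fin fine_ge0.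
  rewrite big_nat_cond [leRHS]big_nat_cond; apply: lee_sum => t /andP[tT _].
  have mA : measurable (A t) by apply: (history_arm_measurable run _ (hA _)).
  rewrite fineK ?fin_num_measure//; apply: le_integral_likelihood => //.
    by case: t tT {mA} => //= t tT; apply: ltnW.
  by move=> w; exact: AZ.
rewrite leeDl//; apply: integral_ge0 => w _; rewrite lee_fin likelihood_ge0//.
Qed.

End disjoint_events.
End likelihood_bounds.

(** * Real-valued probabilities, pull counts and events of the history *)

Section real_probability.
Context d (Om : measurableType d) (R : realType) (P : probability Om R).
Implicit Types A B : set Om.

Definition pr A : R := fine (P A).

Lemma pr_ge0 A : 0 <= pr A. Proof. exact: fine_ge0. Qed.

Lemma prE A : measurable A -> P A = (pr A)%:E.
Proof. by move=> mA; rewrite fineK// fin_num_measure. Qed.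

Lemma pr_le A B : measurable A -> measurable B -> A `<=` B -> pr A <= pr B.
Proof.
by move=> mA mB AB; rewrite -lee_fin -!prE//; apply: le_measure; rewrite ?inE.
Qed.

Lemma pr_le1 A : measurable A -> pr A <= 1.
Proof. by move=> mA; rewrite -lee_fin -prE// probability_le1. Qed.

Lemma prU A B : measurable A -> measurable B -> pr (A `|` B) <= pr A + pr B.
Proof.
move=> mA mB; rewrite -lee_fin EFinD -!prE//; last exact: measurableU.
exact: measureU2.
Qed.

Lemma pr_ae_le A B : measurable A -> measurable B ->
  {ae P, forall w, A w -> B w} -> pr A <= pr B.
Proof.
move=> mA mB [N [mN N0 NAB]].
apply: (@le_trans _ _ (pr (B `|` N))).
  apply: pr_le => //; first exact: measurableU.
  move=> w Aw; have [Bw|Bw] := pselect (B w); [by left|right].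
  by apply: NAB => /= /(_ Aw).
by apply: le_trans (prU mB mN) _; rewrite [X in _ + X]/pr N0 addr0.
Qed.

Lemma pr_bigsetU (I : Type) (s : seq I) (A : I -> set Om) :
  (forall i, measurable (A i)) ->
  pr (\big[setU/set0]_(i <- s) A i) <= \sum_(i <- s) pr (A i).
Proof.
move=> mA; elim: s => [|i s IH]; first by rewrite !big_nil /pr measure0.
rewrite !big_cons (le_trans (prU _ _))//; last by rewrite lerD2l.
exact: bigsetU_measurable.
Qed.

End real_probability.

Lemma mem_bigsetU (T : Type) (I : eqType) (s : seq I) (A : I -> set T) i w :
  i \in s -> A i w -> (\big[setU/set0]_(j <- s) A j) w.
Proof.
elim: s => // j s IH; rewrite inE big_cons => /predU1P[<-|si] Aw; first by left.
by right; exact: IH.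
Qed.

Section pull_counts.
Context (R : realType) (K : nat) (d : measure_display) (Om : measurableType d).
Variables (I : nat -> Om -> 'I_K) (r : nat -> Om -> R).

Lemma pullsS t a w : pulls I t.+1 a w = (pulls I t a w + (I t.+1 w == a))%N.
Proof. by rewrite /pulls big_nat_recr. Qed.

Lemma pulls_le s t a w : (s <= t)%N -> (pulls I s a w <= pulls I t a w)%N.
Proof.
elim: t => [|t IH]; first by rewrite leqn0 => /eqP->.
rewrite leq_eqVlt => /predU1P[->//|]; rewrite ltnS => /IH h.
by rewrite pullsS (leq_trans h)// leq_addr.
Qed.

Lemma pulls_leq t a w : (pulls I t a w <= t)%N.
Proof.
elim: t => [|t IH]; first by rewrite /pulls big_geq.
by rewrite pullsS -addn1 leq_add// leq_b1.
Qed.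

Lemma pullsE t a w : (pulls I t a w)%:R = \sum_(1 <= i < t.+1 | I i w == a) 1 :> R.
Proof. by rewrite /pulls natr_sum [RHS]big_mkcond; apply: eq_bigr => i _; case: eqP. Qed.

Lemma emp_meanE t a w :
  \sum_(1 <= i < t.+1 | I i w == a) r i w = (pulls I t a w)%:R * emp_mean I r t a w.
Proof.
rewrite /emp_mean; have [p0|p0] := eqVneq (pulls I t a w) 0%N; last first.
  by rewrite mulrC divfK// pnatr_eq0.
(* Without a pull the sum is empty, since an index [i] with [I i w == a] would make the count
   positive; the division by zero in [emp_mean] is harmless. *)
rewrite p0 mul0r; apply: big1_seq => i /andP[ia]; rewrite mem_index_iota => /andP[i1 it].
have := @pulls_le i t a w; rewrite -ltnS it => /(_ isT).
rewrite p0 leqn0 => /eqP; case: i i1 ia {it} => // i _ ia.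
by rewrite pullsS ia addn1.
Qed.

(** Sufficiency: for an exponential tilt, the likelihood depends on the rewards only through the
    count and the empirical mean. *)
Lemma likelihood_expR l p t a w :
  likelihood I r a (fun x => expR (l * x - p)) t w =
  expR ((pulls I t a w)%:R * (l * emp_mean I r t a w - p)).
Proof.
rewrite /likelihood -expR_sum big_split/= -big_distrr/= emp_meanE.
rewrite mulrBr mulrCA; congr (expR (_ + _)).
rewrite -mulrN pullsE mulr_suml; apply: eq_bigr => i _; by rewrite mul1r.
Qed.

End pull_counts.

Section history_events.
Context (R : realType) (K : nat) (d : measure_display) (Om : measurableType d).
Variables (I : nat -> Om -> 'I_K) (r : nat -> Om -> R).

Lemma measurable_arm_sum (h : R -> R) t a : measurable_fun setT h ->
  measurable_fun setT ((fun w => \sum_(1 <= i < t.+1 | I i w == a) h (r i w))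
    : g_sigma_algebraType (past_events I r t.+1) -> R).
Proof.
move=> mh; pose Gt := past_events I r t.+1.
suff H n : (n <= t)%N -> measurable_fun setT
    ((fun w => \sum_(1 <= i < n.+1 | I i w == a) h (r i w))
       : g_sigma_algebraType Gt -> R) by exact: H.
elim: n => [_|n IH nt].
  rewrite (_ : (fun _ => _) = cst 0)//.
  by apply/funext => w; rewrite big_geq.
rewrite (_ : (fun _ => _) = (fun w => \sum_(1 <= i < n.+1 | I i w == a) h (r i w) +
    (if I n.+1 w == a then h (r n.+1 w) else 0))); last first.
  by apply/funext => w; rewrite big_mkcond [in RHS]big_mkcond big_nat_recr.
apply: (@measurable_funD _ (g_sigma_algebraType Gt)); first by apply: IH; exact: ltnW.
have iT : (1 <= n.+1 < t.+1)%N by [].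
apply: measurable_fun_ifT => //.
  apply: (@measurable_fun_bool _ _ _ _ true); rewrite setTI.
  rewrite (_ : _ @^-1` _ = I n.+1 @^-1` [set a]); first exact: arm_history.
  by apply/seteqP; split => w /= /eqP.
by apply: measurableT_comp => // _ B mB; rewrite setTI; exact: reward_history.
Qed.

Lemma history_pulls t a (B : set R) : (0 < t)%N -> measurable B ->
  history I r t [set w | B (pulls I t.-1 a w)%:R].
Proof.
case: t => // t _ mB.
have := @measurable_arm_sum (cst 1) t a (@measurable_cst _ _ _ _ setT (1 : R)) measurableT B mB.
rewrite setTI (_ : _ @^-1` B = [set w | B (pulls I t a w)%:R])//.
by apply/seteqP; split => w /=; rewrite pullsE.
Qed.

Lemma history_pulls_eq t a k : (0 < t)%N ->
  history I r t [set w | pulls I t.-1 a w = k].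
Proof.
move=> t0; have := @history_pulls t a [set k%:R] t0 (measurable_set1 _).
rewrite (_ : [set w | _] = [set w | pulls I t.-1 a w = k])//.
by apply/seteqP; split => w /= => [/eqP|->//]; rewrite eqr_nat => /eqP.
Qed.

Lemma history_pulls_ge t a k : (0 < t)%N ->
  history I r t [set w | (k <= pulls I t.-1 a w)%N].
Proof.
move=> t0; have := @history_pulls t a `[k%:R, +oo[%classic t0 (measurable_itv _).
rewrite (_ : [set w | _] = [set w | (k <= pulls I t.-1 a w)%N])//.
by apply/seteqP; split => w /=; rewrite in_itv/= andbT ler_nat.
Qed.

Lemma history_emp_mean t a (B : set R) : (0 < t)%N -> measurable B ->
  history I r t [set w | B (emp_mean I r t.-1 a w)].
Proof.
case: t => // t _ mB.
pose S w := \sum_(1 <= i < t.+1 | I i w == a) r i w.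
have mS : measurable_fun setT (S : g_sigma_algebraType (past_events I r t.+1) -> R).
  exact: (@measurable_arm_sum id t a (@measurable_id _ _ setT)).
(* The denominator is random, so the event is cut into countably many slices on which the count is
   fixed. *)
rewrite (_ : [set w | _] = \bigcup_k
    ([set w | pulls I t a w = k] `&` [set w | B (S w * k%:R^-1)])).
  apply: (@bigcupT_measurable _ (g_sigma_algebraType (past_events I r t.+1))) => k.
  apply: (@measurableI _ (g_sigma_algebraType (past_events I r t.+1))).
    exact: (@history_pulls_eq t.+1 a k).
  have : measurable_fun setT
      ((fun w => S w * k%:R^-1) : g_sigma_algebraType (past_events I r t.+1) -> R).
    exact: (@measurable_funM _ (g_sigma_algebraType (past_events I r t.+1))).
  by move=> /(_ measurableT B mB); rewrite setTI.
apply/seteqP; split => [w Bw|w [k _ [/= <-]]//].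
by exists (pulls I t a w).
Qed.

End history_events.

(** * Deviations of the empirical means *)

Section deviations.
Context (R : realType) (F : exp_family R) (K : nat).
Context (d : measure_display) (Om : measurableType d) (P : probability Om R).
Variables (I : nat -> Om -> 'I_K) (r : nat -> Om -> R).
Variables (theta : 'I_K -> R) (T : nat).
Hypothesis run : exp_kl_ms_run F I r P (fun a => member F (theta a)) T.
Hypothesis ptheta : forall a, params F (theta a).
Local Notation b := (log_partition (base F)).

(** Logarithm of the density at [y] of the member [s] relative to the member [t]. *)
Definition loglik_ratio (s t y : R) : R := (s - t) * y - (b s - b t).

Lemma integral_loglik_ratio s a : params F s ->
  (\int[member F (theta a)]_x (expR (loglik_ratio s (theta a) x))%:E = 1)%E.
Proof.
by move=> ps; rewrite -(member_density (ptheta a) ps measurableT) probability_setT.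
Qed.

Lemma measurable_loglik_ratio s a :
  measurable_fun setT (fun x => expR (loglik_ratio s (theta a) x)).
Proof. exact: measurable_expR_affine. Qed.

(** A pull of [a] raises its count, so the count equals [k] at a pull of [a] in at most one round.
    The events are therefore disjoint in [t], and the sum over rounds costs no factor [T]. *)
Lemma pull_deviation a s (k : nat) (z : R) (B : set R) : params F s ->
  measurable B -> (forall y, B y -> z <= loglik_ratio s (theta a) y) ->
  \sum_(1 <= t < T.+1) pr P [set w | [/\ I t w = a, pulls I t.-1 a w = k &
    B (emp_mean I r t.-1 a w)]] <= expR (- (k%:R * z)).
Proof.
move=> ps mB Bz.
apply: (chernoff_disjoint run (measurable_loglik_ratio s a)
  (fun=> expR_ge0 _) (integral_loglik_ratio a ps)).
- move=> t /andP[t1 tT].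
  rewrite (_ : [set w | _] = I t @^-1` [set a] `&`
      ([set w | pulls I t.-1 a w = k] `&` [set w | B (emp_mean I r t.-1 a w)])).
    apply: (@measurableI _ (g_sigma_algebraType (arm_events I r t))).
      exact: arm_history_arm.
    apply: (@measurableI _ (g_sigma_algebraType (arm_events I r t))).
      by apply: sub_history_arm; exact: history_pulls_eq.
    by apply: sub_history_arm; exact: history_emp_mean.
  by apply/seteqP; split => w /= [h1]; [|case]; move=> h2 h3; split.
- move=> s' t w /andP[s1 st] [Is ps' _] [_ pt _].
  case: s' s1 st Is ps' => // s' _ st Is ps'.
  have st' : (s'.+1 <= t.-1)%N by rewrite -ltnS prednK// (leq_trans _ st).
  have := pulls_le I a w st'; rewrite pullsS Is eqxx pt.
  by rewrite [pulls I s' a w]ps' addn1 ltnn.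
- move=> t w tT [_ pk By].
  rewrite likelihood_expR ler_expR pk ler_wpM2l//.
  exact: Bz.
Qed.

(** The instance of [pull_deviation] in which the likelihood ratio is constantly one. *)
Lemma pull_count a (k : nat) :
  \sum_(1 <= t < T.+1) pr P [set w | I t w = a /\ pulls I t.-1 a w = k] <= 1.
Proof.
have := @pull_deviation a (theta a) k 0 setT (ptheta a) measurableT _.
rewrite mulr0 oppr0 expR0 => h; apply: le_trans (h _).
  apply: ler_sum => t _; rewrite le_eqVlt; apply/orP; left; apply/eqP; congr (pr P _).
  by apply/seteqP; split => w /= [].
by move=> y _; rewrite /loglik_ratio !subrr mul0r subr0.
Qed.

(** Here no pull is demanded and the count is only bounded below, so the events of different rounds
    may overlap. Markov's inequality is used in a single round, and a later sum over rounds costs a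
    factor [T]. *)
Lemma state_deviation a s (n : nat) (z : R) (B : set R) t : params F s ->
  (1 <= t <= T)%N -> measurable B -> 0 <= z ->
  (forall y, B y -> z <= loglik_ratio s (theta a) y) ->
  pr P [set w | (n <= pulls I t.-1 a w)%N /\ B (emp_mean I r t.-1 a w)]
    <= expR (- (n%:R * z)).
Proof.
move=> ps /andP[t1 tT] mB z0 Bz.
have tT' : (t.-1 <= T)%N by rewrite (leq_trans (leq_pred t)).
apply: (markov_likelihood run (measurable_loglik_ratio s a) (fun=> expR_ge0 _)
  (integral_loglik_ratio a ps) tT').
  apply: measurableI; apply: (@history_measurable _ _ _ _ _ _ _ _ _ _ run t _ (leqW tT)).
    exact: history_pulls_ge.
  exact: history_emp_mean.
move=> w [nw Bw]; rewrite likelihood_expR ler_expR.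
by rewrite ler_pM// ?ler0n ?ler_nat// Bz.
Qed.

End deviations.

(** * Sampling probabilities of Exp-KL-MS *)

Section selection.
Context (R : realType) (F : exp_family R) (K : nat).
Context (d : measure_display) (Om : measurableType d) (P : probability Om R).
Variables (I : nat -> Om -> 'I_K) (r : nat -> Om -> R).
Variables (nu : 'I_K -> probability R R) (T : nat).
Hypothesis run : exp_kl_ms_run F I r P nu T.
Hypothesis K0 : (0 < K)%N.
Hypothesis regF : regular_log_partition F.
Hypothesis params2 : exists s t, [/\ params F s, params F t & s < t].
Local Notation q := (exp_kl_ms F I r).
Local Notation kl := (kl_params F).
Local Notation m := (mean F).

Definition regular_state (t : nat) (w : Om) : Prop :=
  forall a, (0 < pulls I t.-1 a w)%N /\ means F (emp_mean I r t.-1 a w).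

Lemma run_regular_state : {ae P, forall w, forall t,
  (K < t <= T)%N -> regular_state t w}.
Proof.
have [TK|KT] := leqP T K.
  by apply: nearW => w t /andP[Kt tT]; move: (leq_ltn_trans TK Kt); rewrite ltnNge tT.
(* Arms are numbered from 0 and rounds from 1: in round [a.+1] the rule gives arm [a] probability
   one, so each arm is almost surely pulled during the first [K] rounds. *)
have H (a : 'I_K) : {ae P, forall w, I a.+1 w = a}.
  have aT : (1 <= a.+1 <= T)%N by rewrite /= (leq_trans (ltn_ord a))// ltnW.
  have mI := run_measI run a aT.
  have [_ h] := run_arm run a aT.
  exists (~` (I a.+1 @^-1` [set a])); split => //; first exact: measurableC.
  have hT : history I r a.+1 setT.
    exact: (@measurableT _ (g_sigma_algebraType (past_events I r a.+1))).
  have := h _ hT; rewrite setIT => e; rewrite probability_setC//.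
  rewrite [X in (1 - X)%E]e.
  under eq_integral do rewrite /exp_kl_ms ltn_ord eqxx.
  have := expectation_cst P (1 : R); rewrite unlock => ->.
  by rewrite subee.
have FP := ae_filter_ringOfSetsType P.
have HH := @filterI _ _ FP _ _ (@filter_forall _ _ _ _ FP H) (run_emp_mean run).
apply: (@filterS _ _ FP) HH => w [Iw emp] t.
move=> /andP[Kt tT] a.
have t1 : (t.-1.+1 = t)%N by rewrite prednK// (leq_trans _ Kt).
have pos : (0 < pulls I t.-1 a w)%N.
  apply: (@leq_trans (pulls I a.+1 a w)).
    by rewrite pullsS Iw eqxx addn1.
  by apply: pulls_le; rewrite -ltnS t1 (leq_ltn_trans (ltn_ord a)).
split => //; apply: emp => //.
rewrite (leq_trans (leq_pred t) tT) andbT -ltnS t1.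
by rewrite (leq_ltn_trans _ Kt).
Qed.

Section fixed_state.
Variables (t : nat) (w : Om).
Hypothesis Kt : (K < t)%N.
Hypothesis reg : regular_state t w.

Lemma emp_param a : exists2 s, params F s & m s = emp_mean I r t.-1 a w.
Proof. by have [_ [s ps e]] := reg a; exists s. Qed.

Lemma emp_max_param : exists2 s, params F s & m s = emp_max I r t.-1 w.
Proof.
have [a e] := max_arm_attained (fun a => emp_mean I r t.-1 a w) K0.
by have [s ps se] := emp_param a; exists s => //; rewrite /emp_max e.
Qed.

Lemma weightE a s smax : params F s -> params F smax ->
  m s = emp_mean I r t.-1 a w -> m smax = emp_max I r t.-1 w ->
  weight F I r t a w = expR (- ((pulls I t.-1 a w).-1%:R * kl s smax)).
Proof.
move=> ps pmax e emax; rewrite /weight -e -emax KL_kl// mulNr.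
by have [p0 _] := reg a; rewrite -[(pulls I t.-1 a w).-1]subn1 natrB.
Qed.

Lemma weight_gt0 a : 0 < weight F I r t a w.
Proof. exact: expR_gt0. Qed.

Lemma weight_le1 a : weight F I r t a w <= 1.
Proof.
have [s ps e] := emp_param a; have [smax pmax emax] := emp_max_param.
rewrite (weightE ps pmax e emax) -expR0 ler_expR oppr_le0 mulr_ge0//.
exact: kl_ge0.
Qed.

(** The arm with the largest empirical mean has weight [expR 0]. *)
Lemma sum_weight_ge1 : 1 <= \sum_a' weight F I r t a' w.
Proof.
have [a ea] := max_arm_attained (fun a => emp_mean I r t.-1 a w) K0.
have [s ps e] := emp_param a.
rewrite (bigD1 a)//= (weightE ps ps e) ?e//.
by rewrite kl_refl mulr0 oppr0 expR0 lerDl sumr_ge0// => i _; rewrite ltW// weight_gt0.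
Qed.

Lemma select_le_weight a : q t a w <= weight F I r t a w.
Proof.
rewrite /exp_kl_ms leqNgt Kt/= ler_pdivrMr ?(lt_le_trans ltr01 sum_weight_ge1)//.
by rewrite ler_peMr ?sum_weight_ge1// ltW// weight_gt0.
Qed.

(** The weight of [a] is at most one, so [q t a w] is at most the inverse normalizer, which is
    [q t o w] divided by the weight of [o]. *)
Lemma select_le_ratio a o : q t a w <= (weight F I r t o w)^-1 * q t o w.
Proof.
rewrite /exp_kl_ms leqNgt Kt/= mulrA mulVf ?gt_eqF ?weight_gt0// ler_wpM2r ?weight_le1//.
by rewrite invr_ge0 (le_trans ler01 sum_weight_ge1).
Qed.

End fixed_state.

Lemma select_ge0 t a w : 0 <= q t a w.
Proof.
rewrite /exp_kl_ms; case: ifP => // _; rewrite divr_ge0 ?expR_ge0//.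
by apply: sumr_ge0 => i _; exact: expR_ge0.
Qed.

Lemma measurable_select t a : (1 <= t <= T)%N -> measurable_fun setT (q t a).
Proof.
move=> tT _ B mB; rewrite setTI; have [h _] := run_arm run a tT.
by apply: (history_measurable run _ (h _ mB)); case/andP: tT => _ /leqW.
Qed.

Lemma select_prob_ratio t a o H c : (1 <= t <= T)%N -> history I r t H ->
  0 <= c -> {ae P, forall w, H w -> q t a w <= c * q t o w} ->
  pr P (I t @^-1` [set a] `&` H) <= c * pr P (I t @^-1` [set o] `&` H).
Proof.
move=> tT hH c0 qc.
have mH : measurable H.
  by apply: (history_measurable run _ hH); case/andP: tT => _ /leqW.
have mI i := run_measI run i tT.
have [_ ha] := run_arm run a tT; have [_ ho] := run_arm run o tT.
rewrite -lee_fin EFinM -!prE; [|exact: measurableI..].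
rewrite ha// ho// -ge0_integralZl_EFin//; last 2 first.
- by move=> w _; rewrite lee_fin select_ge0.
- by apply/measurable_EFinP; apply: measurable_funTS; exact: measurable_select.
apply: ae_ge0_le_integral => //.
- by move=> w _; rewrite lee_fin select_ge0.
- by apply/measurable_EFinP; apply: measurable_funTS; exact: measurable_select.
- by move=> w _; rewrite -EFinM lee_fin mulr_ge0// select_ge0.
- apply/measurable_EFinP; apply: measurable_funTS; apply: measurable_funM => //.
  exact: measurable_select.
Qed.

Lemma select_prob_le t a H c : (1 <= t <= T)%N -> history I r t H ->
  0 <= c -> {ae P, forall w, H w -> q t a w <= c} ->
  pr P (I t @^-1` [set a] `&` H) <= c.
Proof.
move=> tT hH c0 qc.
have mH : measurable H.
  by apply: (history_measurable run _ hH); case/andP: tT => _ /leqW.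
have mI := run_measI run a tT.
have [_ ha] := run_arm run a tT.
apply: (@le_trans _ _ (c * pr P H)); last first.
  by rewrite ler_piMr// pr_le1.
rewrite -lee_fin EFinM -!prE//; last exact: measurableI.
rewrite ha// -integral_cst//.
apply: ae_ge0_le_integral => //.
- by move=> w _; rewrite lee_fin select_ge0.
- by apply/measurable_EFinP; apply: measurable_funTS; exact: measurable_select.
Qed.

End selection.

(** * Expected number of pulls of a suboptimal arm *)

Lemma first_failure (Q : nat -> Prop) J : Q 0%N -> ~ Q J ->
  exists2 j, (j < J)%N & Q j /\ ~ Q j.+1.
Proof.
move=> Q0; elim: J => // J IH QJ.
have [QJ'|/IH[j jJ h]] := pselect (Q J); first by exists J.
by exists j => //; rewrite ltnS ltnW.
Qed.

Section arm_bound.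
Context (R : realType) (F : exp_family R) (K : nat).
Context (d : measure_display) (Om : measurableType d) (P : probability Om R).
Variables (I : nat -> Om -> 'I_K) (r : nat -> Om -> R).
Variables (theta : 'I_K -> R) (T : nat).
Hypothesis run : exp_kl_ms_run F I r P (fun a => member F (theta a)) T.
Hypothesis K0 : (0 < K)%N.
Hypothesis ptheta : forall a, params F (theta a).
Hypothesis regF : regular_log_partition F.
Hypothesis params2 : exists s t, [/\ params F s, params F t & s < t].
Local Notation q := (exp_kl_ms F I r).
Local Notation kl := (kl_params F).
Local Notation m := (mean F).

Variables (a o : 'I_K) (s1 s2 x : R).
Hypotheses (ps1 : params F s1) (ps2 : params F s2).
Hypotheses (as1 : theta a <= s1) (s12 : s1 <= s2) (s2o : s2 <= theta o).
Hypotheses (x0 : 0 <= x) (xa : x <= kl s1 (theta a)) (x12 : x <= kl s1 s2)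
  (xo : x <= kl s2 (theta o)).

Lemma loglik_ratio_mean s t : loglik_ratio F s t (m s) = kl s t.
Proof. by rewrite /loglik_ratio /kl_params opprB addrA addrAC. Qed.

(** The condition that the divergence to [s2] is at least [v] is turned into a Borel set of
    empirical means, a half-line ending at the mean of the [s'] with [kl s' s2 = v], or the empty
    set if [v] is never reached. The same [s'] tilts the likelihood, and superadditivity through
    [s2] adds the margin [x]. *)
Lemma level_set v : 0 <= v -> exists B : set R, [/\ measurable B,
  forall s, params F s -> s <= s2 -> v <= kl s s2 -> B (m s) &
  exists2 s', params F s' & forall y, B y -> v + x <= loglik_ratio F s' (theta o) y].
Proof.
move=> v0; have po := ptheta o.
have [[s [ps ss2 vs]]|none] :=
  pselect (exists s, [/\ params F s, s <= s2 & v <= kl s s2]); last first.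
  exists set0; split => // [s ps ss2 vs|].
    by apply: none; exists s.
  by exists (theta o).
have [|s' /andP[ss' s's2] e] := kl_IVT regF params2 ps ps2 ss2 (v := v).
  by rewrite v0.
have ps' : params F s' by apply: (params_between ps ps2); rewrite ss'.
exists `]-oo, m s']%classic; split; first exact: measurable_itv.
  move=> z pz zs2 vz; rewrite /= in_itv/=.
  have [zs'|s'z] := leP z s'; first exact: mean_le.
  (* Between [s'] and [s2] the divergence to [s2] strictly decreases, so a [z] beyond [s'] would
     have divergence below [v]. *)
  suff : kl z s2 < kl s' s2 by rewrite e ltNge vz.
  apply: (lt_le_trans _ (kl_superadditive regF params2 ps' pz ps2 _)).
    by rewrite ltrDr kl_gt0// lt_eqF.
  by rewrite (ltW s'z) zs2.
exists s' => // y; rewrite /= in_itv/= => ys'.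
(* The slope [s' - theta o] is nonpositive, so on the half-line the ratio is least at its endpoint
   [m s']. *)
apply: (@le_trans _ _ (loglik_ratio F s' (theta o) (m s'))); last first.
  rewrite /loglik_ratio lerD2r ler_wnM2l// subr_le0.
  exact: le_trans s2o.
rewrite loglik_ratio_mean -e.
apply: (le_trans _ (kl_superadditive regF params2 ps' ps2 po _)).
  by rewrite lerD2l.
by rewrite s's2 s2o.
Qed.

Lemma level_sets : exists B : R -> set R, forall v, 0 <= v -> [/\ measurable (B v),
  forall s, params F s -> s <= s2 -> v <= kl s s2 -> B v (m s) &
  exists2 s', params F s' & forall y, B v y -> v + x <= loglik_ratio F s' (theta o) y].
Proof.
have H v : exists B : set R, 0 <= v -> [/\ measurable B,
  forall s, params F s -> s <= s2 -> v <= kl s s2 -> B (m s) &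
  exists2 s', params F s' & forall y, B y -> v + x <= loglik_ratio F s' (theta o) y].
  have [v0|v0] := leP 0 v; last by exists set0.
  by have [B HB] := level_set v0; exists B.
by have [B HB] := choice H; exists B.
Qed.

(** The largest empirical mean depends on all arms. Since it is at most [m s2], it can be replaced
    by the fixed [s2], which only increases the divergence from the empirical mean of [o]; what
    remains involves [o] alone. *)
Lemma underestimated_max_select t (H : set Om) (k : nat) v : (K < t <= T)%N ->
  0 <= v -> history I r t H ->
  (forall w, regular_state F I r t w -> H w -> [/\ pulls I t.-1 o w = k,
     emp_max I r t.-1 w <= m s2 &
     forall s, params F s -> m s = emp_mean I r t.-1 o w -> kl s s2 <= v]) ->
  pr P (I t @^-1` [set a] `&` H) <= expR (k%:R * v) * pr P (I t @^-1` [set o] `&` H).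
Proof.
move=> /andP[Kt tT] v0 hH Hk.
have t1T : (1 <= t <= T)%N by rewrite tT (leq_ltn_trans _ Kt).
apply: (select_prob_ratio run t1T hH (expR_ge0 _)).
have HH := run_regular_state run K0.
have FP := ae_filter_ringOfSetsType P.
apply: (@filterS _ _ FP) HH => w regw Hw.
have {}regw : regular_state F I r t w by apply: regw; rewrite Kt.
have [Nk emax klv] := Hk w regw Hw.
apply: (le_trans (select_le_ratio K0 regF params2 Kt regw a o)).
apply: ler_wpM2r; first exact: select_ge0.
have [s ps es] := emp_param regw o.
have [smax pmax esmax] := emp_max_param K0 regw.
rewrite (weightE regF params2 regw ps pmax es esmax) -expRN opprK ler_expR Nk.
have smax2 : smax <= s2 by apply: (mean_le_inv regF params2) => //; rewrite esmax.
have ssmax : s <= smax.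
  apply: (mean_le_inv regF params2) => //; rewrite es esmax.
  exact: (max_arm_ge (fun a => emp_mean I r t.-1 a w)).
apply: ler_pM; [exact: ler0n|exact: kl_ge0|by rewrite ler_nat leq_pred|].
apply: le_trans (klv _ ps es).
by apply: kl_mono_r.
Qed.

Lemma well_estimated_select t (u : nat) (H : set Om) : (K < t <= T)%N ->
  history I r t H ->
  (forall w, H w -> [/\ (u < pulls I t.-1 a w)%N,
     emp_mean I r t.-1 a w <= m s1 & m s2 <= emp_max I r t.-1 w]) ->
  pr P (I t @^-1` [set a] `&` H) <= expR (- (u%:R * x)).
Proof.
move=> /andP[Kt tT] hH Hw.
have t1T : (1 <= t <= T)%N by rewrite tT (leq_ltn_trans _ Kt).
apply: (select_prob_le run t1T hH (expR_ge0 _)).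
have HH := run_regular_state run K0.
have FP := ae_filter_ringOfSetsType P.
apply: (@filterS _ _ FP) HH => w regw /Hw[uN e1 e2].
have {}regw : regular_state F I r t w by apply: regw; rewrite Kt.
apply: (le_trans (select_le_weight K0 regF params2 Kt regw a)).
have [s ps es] := emp_param regw a.
have [smax pmax esmax] := emp_max_param K0 regw.
rewrite (weightE regF params2 regw ps pmax es esmax) ler_expR lerN2.
have ss1 : s <= s1 by apply: (mean_le_inv regF params2) => //; rewrite es.
have s2max : s2 <= smax by apply: (mean_le_inv regF params2) => //; rewrite esmax.
apply: ler_pM; [exact: ler0n|exact: x0| |].
  (* The weight uses the count minus one, hence the strict inequality between [u] and the count. *)
  by rewrite ler_nat -ltnS prednK ?(leq_ltn_trans _ uN).
apply: (le_trans x12).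
apply: (le_trans (kl_mono_r regF params2 ps1 ps2 pmax s12 s2max)).
by apply: (kl_anti_l regF params2) => //; exact: le_trans s2max.
Qed.

Section one_round.
Variables (u : nat) (J : nat -> nat) (B : R -> set R).
Hypothesis HB : forall v, 0 <= v -> [/\ measurable (B v),
  forall s, params F s -> s <= s2 -> v <= kl s s2 -> B v (m s) &
  exists2 s', params F s' & forall y, B v y -> v + x <= loglik_ratio F s' (theta o) y].
Variable t : nat.
Hypothesis Kt : (K < t <= T)%N.

Let lev i j : R := j%:R / (4 ^ i)%:R.
Let lev_ge0 i j : 0 <= lev i j. Proof. by rewrite divr_ge0. Qed.

(** The largest empirical mean is at least [m s2], written as a finite union over arms so that it
    visibly belongs to the history. *)
Definition high_max : set Om :=
  \bigcup_a' [set w | `[m s2, +oo[%classic (emp_mean I r t.-1 a' w)].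

Definition good_event : set Om :=
  [set w | (u < pulls I t.-1 a w)%N] `&`
  ([set w | `]-oo, m s1[%classic (emp_mean I r t.-1 a w)] `&` high_max).

(* Peeling: the number of pulls of [o] is localized in [4^i, 4^(i+1)[ and its
   divergence to [s2] in units of [4^-i]. *)
Definition level_event i k j : set Om :=
  [set w | pulls I t.-1 o w = k] `&`
  ([set w | (B (lev i j) `\` B (lev i j.+1)) (emp_mean I r t.-1 o w)] `&` ~` high_max).

(** Beyond the last level the comparison with pulls of [o] is given up, since the ratio of selection
    probabilities is no longer controlled; only the state of [o] is recorded. *)
Definition tail_event i : set Om :=
  [set w | (4 ^ i <= pulls I t.-1 o w)%N /\ B (lev i (J i)) (emp_mean I r t.-1 o w)].

Let t0 : (0 < t)%N. Proof. by case/andP: Kt => h _; exact: leq_trans h. Qed.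
Let tT : (t <= T)%N. Proof. by case/andP: Kt. Qed.
Let t1T : (1 <= t <= T)%N. Proof. by rewrite t0 tT. Qed.

Let hI A1 A2 : history I r t A1 -> history I r t A2 -> history I r t (A1 `&` A2).
Proof. exact: (@measurableI _ (g_sigma_algebraType (past_events I r t))). Qed.

Let hmeas A1 : history I r t A1 -> measurable A1.
Proof. by apply: (history_measurable run); exact: leqW. Qed.

Lemma history_high_max : history I r t high_max.
Proof.
apply: (@fin_bigcup_measurable _ (g_sigma_algebraType (past_events I r t))).
  exact: finite_finset.
by move=> a' _; apply: history_emp_mean => //; exact: measurable_itv.
Qed.

Lemma history_good_event : history I r t good_event.
Proof.
apply: hI; first exact: history_pulls_ge.
apply: hI; last exact: history_high_max.
by apply: history_emp_mean => //; exact: measurable_itv.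
Qed.

Lemma history_level_event i k j : history I r t (level_event i k j).
Proof.
apply: hI; first exact: history_pulls_eq.
apply: hI; last first.
  exact: (@measurableC _ (g_sigma_algebraType (past_events I r t)) _ history_high_max).
have [m1 _ _] := HB (lev_ge0 i j); have [m2 _ _] := HB (lev_ge0 i j.+1).
by apply: history_emp_mean => //; exact: measurableD.
Qed.

Lemma history_tail_event i : history I r t (tail_event i).
Proof.
have [m1 _ _] := HB (lev_ge0 i (J i)).
by apply: hI; [exact: history_pulls_ge|exact: history_emp_mean].
Qed.

Lemma pr_good_event : pr P (I t @^-1` [set a] `&` good_event) <= expR (- (u%:R * x)).
Proof.
apply: well_estimated_select => //; first exact: history_good_event.
move=> w [uN []]; rewrite /= in_itv/= => e1 [a' _]; rewrite /= in_itv/= andbT => e2.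
split => //; first exact: ltW.
exact: le_trans e2 (max_arm_ge (fun a => emp_mean I r t.-1 a w) a').
Qed.

Lemma pr_level_event i k j :
  pr P (I t @^-1` [set a] `&` level_event i k j) <=
  expR (k%:R * lev i j.+1) * pr P [set w | [/\ I t w = o, pulls I t.-1 o w = k &
    B (lev i j) (emp_mean I r t.-1 o w)]].
Proof.
have hL := history_level_event i k j.
have mI := run_measI run o t1T.
apply: (le_trans (underestimated_max_select Kt (lev_ge0 i j.+1) hL _ (k := k))).
  move=> w regw [/= Nk [[_ nB] nmax]].
  have [_ inB _] := HB (lev_ge0 i j.+1).
  have low a' : emp_mean I r t.-1 a' w < m s2.
    rewrite ltNge; apply/negP => h; apply: nmax; exists a' => //.
    by rewrite /= in_itv/= h.
  split => //.
    have [a' e] := max_arm_attained (fun a => emp_mean I r t.-1 a w) K0.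
    by rewrite /emp_max e ltW.
  move=> s ps es; rewrite leNgt; apply/negP => /ltW h; apply: nB.
  rewrite -es; apply: inB => //.
  by rewrite ltW// (mean_lt_inv regF params2)// es.
apply: ler_wpM2l; first exact: expR_ge0.
apply: pr_le; first by apply: measurableI => //; exact: hmeas.
  rewrite (_ : [set w | _] = I t @^-1` [set o] `&`
      ([set w | pulls I t.-1 o w = k] `&`
       [set w | B (lev i j) (emp_mean I r t.-1 o w)])).
    have [m1 _ _] := HB (lev_ge0 i j).
    apply: measurableI => //; apply: hmeas.
    by apply: hI; [exact: history_pulls_eq|exact: history_emp_mean].
  by apply/seteqP; split => w /= [h1]; [|case]; move=> h2 h3; split.
by move=> w [/= Io [/= Nk [[Bw _] _]]]; split.
Qed.

Lemma pr_tail_event i : pr P (tail_event i) <=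
  expR (- ((4 ^ i)%:R * (lev i (J i) + x))).
Proof.
have [m1 _ [s' ps' hs']] := HB (lev_ge0 i (J i)).
have lx0 : 0 <= lev i (J i) + x by rewrite addr_ge0// lev_ge0.
exact: (state_deviation run ptheta (4 ^ i) ps' t1T m1 lx0 hs').
Qed.

Lemma pull_cover : {ae P, forall w, I t w = a ->
  [\/ exists2 k, (1 <= k < u.+1)%N & pulls I t.-1 a w = k,
     exists2 k, (1 <= k < T.+1)%N & pulls I t.-1 a w = k /\
       `[m s1, +oo[%classic (emp_mean I r t.-1 a w),
     good_event w |
     exists2 i, (i < T)%N & tail_event i w \/
       exists2 k, (4 ^ i <= k < 4 ^ i.+1)%N &
         exists2 j, (j < J i)%N & level_event i k j w]}.
Proof.
have HH := run_regular_state run K0.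
have FP := ae_filter_ringOfSetsType P.
apply: (@filterS _ _ FP) HH => w regw Iw.
have {}regw : regular_state F I r t w by exact: regw.
have posN a' : (0 < pulls I t.-1 a' w)%N by case: (regw a').
have leN a' : (pulls I t.-1 a' w < T)%N.
  by rewrite (leq_ltn_trans (pulls_leq _ _ _ _))// -ltnS prednK// ltnS.
have [uN|uN] := leqP (pulls I t.-1 a w) u.
  by constructor 1; exists (pulls I t.-1 a w) => //; rewrite posN ltnS.
have [e1|e1] := leP (m s1) (emp_mean I r t.-1 a w).
  constructor 2; exists (pulls I t.-1 a w); first by rewrite posN ltnS ltnW.
  by split => //; rewrite /= in_itv/= e1.
have [hm|hm] := pselect (high_max w).
  by constructor 3; split => //; split => //; rewrite /= in_itv/=.
constructor 4.
have /andP[iN Ni] := trunc_log_bounds (isT : 1 < 4)%N (posN o).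
set i := trunc_log 4 _ in iN Ni.
have iT : (i < T)%N.
  by rewrite (leq_ltn_trans _ (leN o))// (leq_trans _ iN)// ltnW// ltn_expl.
exists i => //.
have [BJ|BJ] := pselect (B (lev i (J i)) (emp_mean I r t.-1 o w)).
  by left; split.
right; exists (pulls I t.-1 o w); first by rewrite iN Ni.
(* Outside [high_max] the empirical mean of [o] is below [m s2], and divergences are nonnegative, so
   level 0 holds. Level [J i] fails, hence some level [j] holds whose successor fails. *)
have B0 : B (lev i 0) (emp_mean I r t.-1 o w).
  have [s ps es] := emp_param regw o.
  have [_ inB _] := HB (lev_ge0 i 0); rewrite -es; apply: inB; first exact: ps.
    rewrite ltW// (mean_lt_inv regF params2)// es ltNge; apply/negP => h.
    by apply: hm; exists o => //; rewrite /= in_itv/= h.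
  by rewrite /lev mul0r kl_ge0.
have [j jJ [Bj Bj']] := first_failure (Q := fun j => B (lev i j) (emp_mean I r t.-1 o w)) B0 BJ.
by exists j => //; split => //; split.
Qed.

Lemma pull_prob_le : pr P (I t @^-1` [set a]) <=
  \sum_(1 <= k < u.+1) pr P [set w | I t w = a /\ pulls I t.-1 a w = k] +
  (\sum_(1 <= k < T.+1) pr P [set w | [/\ I t w = a, pulls I t.-1 a w = k &
     `[m s1, +oo[%classic (emp_mean I r t.-1 a w)]] +
  (expR (- (u%:R * x)) +
   \sum_(0 <= i < T) (expR (- ((4 ^ i)%:R * (lev i (J i) + x))) +
     \sum_(4 ^ i <= k < 4 ^ i.+1) \sum_(0 <= j < J i)
       expR (k%:R * lev i j.+1) * pr P [set w | [/\ I t w = o,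
         pulls I t.-1 o w = k & B (lev i j) (emp_mean I r t.-1 o w)]]))).
Proof.
have mIa := run_measI run a t1T.
pose S1 k := [set w | I t w = a /\ pulls I t.-1 a w = k].
pose S2 k := [set w | [/\ I t w = a, pulls I t.-1 a w = k &
     `[m s1, +oo[%classic (emp_mean I r t.-1 a w)]].
pose S3 := I t @^-1` [set a] `&` good_event.
pose S4 i k j := I t @^-1` [set a] `&` level_event i k j.
pose S5 i := \big[setU/set0]_(4 ^ i <= k < 4 ^ i.+1) \big[setU/set0]_(0 <= j < J i) S4 i k j.
have m1 k : measurable (S1 k).
  by apply: measurableI => //; apply: hmeas; exact: history_pulls_eq.
have m2 k : measurable (S2 k).
  rewrite (_ : S2 k = I t @^-1` [set a] `&`
      ([set w | pulls I t.-1 a w = k] `&`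
       [set w | `[m s1, +oo[%classic (emp_mean I r t.-1 a w)])).
    apply: measurableI => //; apply: hmeas.
    apply: hI; first exact: history_pulls_eq.
    by apply: history_emp_mean => //; exact: measurable_itv.
  by apply/seteqP; split => w /= [h1]; [|case]; move=> h2 h3; split.
have m3 : measurable S3 by apply: measurableI => //; apply: hmeas; exact: history_good_event.
have m4 i k j : measurable (S4 i k j).
  by apply: measurableI => //; apply: hmeas; exact: history_level_event.
have mt i : measurable (tail_event i) by apply: hmeas; exact: history_tail_event.
have m5' i k : measurable (\big[setU/set0]_(0 <= j < J i) S4 i k j).
  exact: bigsetU_measurable.
have m5 i : measurable (S5 i) by exact: bigsetU_measurable.
pose U1 := \big[setU/set0]_(1 <= k < u.+1) S1 k.
pose U2 := \big[setU/set0]_(1 <= k < T.+1) S2 k.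
pose U4 := \big[setU/set0]_(0 <= i < T) (tail_event i `|` S5 i).
have mU1 : measurable U1 by exact: bigsetU_measurable.
have mU2 : measurable U2 by exact: bigsetU_measurable.
have mt5 i : measurable (tail_event i `|` S5 i) by exact: measurableU.
have mU4 : measurable U4 by exact: bigsetU_measurable.
have mU34 : measurable (S3 `|` U4) by exact: measurableU.
have mU234 : measurable (U2 `|` (S3 `|` U4)) by exact: measurableU.
apply: (@le_trans _ _ (pr P (U1 `|` (U2 `|` (S3 `|` U4))))).
  apply: pr_ae_le => //; first exact: measurableU.
  have FP := ae_filter_ringOfSetsType P.
  apply: (@filterS _ _ FP) pull_cover => w cov /= Iw.
  have [[k kr Nk]|[k kr [Nk e]]|g|[i iT h]] := cov Iw.
  - by left; apply: (mem_bigsetU (i := k)); rewrite ?mem_index_iota.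
  - by right; left; apply: (mem_bigsetU (i := k)); rewrite ?mem_index_iota.
  - by right; right; left; split.
  - right; right; right; apply: (mem_bigsetU (i := i)); rewrite ?mem_index_iota//.
    have [tl|[k kr [j jJ L]]] := h; [by left|right].
    apply: (mem_bigsetU (i := k)); rewrite ?mem_index_iota//.
    by apply: (mem_bigsetU (i := j)); rewrite ?mem_index_iota//; split.
apply: (le_trans (prU _ _ _)) => //; apply: lerD; first exact: pr_bigsetU.
apply: (le_trans (prU _ _ _)) => //; apply: lerD; first exact: pr_bigsetU.
apply: (le_trans (prU _ _ _)) => //; apply: lerD; first exact: pr_good_event.
apply: (le_trans (pr_bigsetU _ _ _)) => //; apply: ler_sum => i _.
apply: (le_trans (prU _ _ _)) => //; apply: lerD; first exact: pr_tail_event.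
apply: (le_trans (pr_bigsetU _ _ _)) => //; apply: ler_sum => k _.
apply: (le_trans (pr_bigsetU _ _ _)) => //; apply: ler_sum => j _.
exact: pr_level_event.
Qed.

End one_round.

(** After exchanging sums, the terms that require a pull at a given count are bounded by one
    deviation bound for all rounds together; the selection term and the tail terms are bounded round
    by round and acquire the factor [T]. *)
Lemma sum_pull_prob_le (u : nat) (J : nat -> nat) :
  \sum_(1 <= t < T.+1 | (K < t)%N) pr P (I t @^-1` [set a]) <=
  u%:R + (\sum_(1 <= k < T.+1) expR (- (k%:R * x)) +
  (T%:R * expR (- (u%:R * x)) +
   \sum_(0 <= i < T) (T%:R * expR (- ((4 ^ i)%:R * ((J i)%:R / (4 ^ i)%:R + x))) +
     \sum_(4 ^ i <= k < 4 ^ i.+1) \sum_(0 <= j < J i)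
       expR (k%:R * (j.+1%:R / (4 ^ i)%:R)) *
       expR (- (k%:R * (j%:R / (4 ^ i)%:R + x)))))).
Proof.
have [B HB] := level_sets.
have sum_cst (c : R) : \sum_(1 <= t < T.+1) c = T%:R * c.
  by rewrite sumr_const_nat subn1 mulr_natl.
have lev0 i j : 0 <= j%:R / (4 ^ i)%:R :> R by rewrite divr_ge0.
apply: (@le_trans _ _ (\sum_(1 <= t < T.+1)
  (\sum_(1 <= k < u.+1) pr P [set w | I t w = a /\ pulls I t.-1 a w = k] +
  (\sum_(1 <= k < T.+1) pr P [set w | [/\ I t w = a, pulls I t.-1 a w = k &
     `[m s1, +oo[%classic (emp_mean I r t.-1 a w)]] +
  (expR (- (u%:R * x)) +
   \sum_(0 <= i < T) (expR (- ((4 ^ i)%:R * ((J i)%:R / (4 ^ i)%:R + x))) +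
     \sum_(4 ^ i <= k < 4 ^ i.+1) \sum_(0 <= j < J i)
       expR (k%:R * (j.+1%:R / (4 ^ i)%:R)) * pr P [set w | [/\ I t w = o,
         pulls I t.-1 o w = k & B (j%:R / (4 ^ i)%:R) (emp_mean I r t.-1 o w)]])))))).
  rewrite big_mkcond big_nat_cond [leRHS]big_nat_cond.
  apply: ler_sum => t /andP[/andP[t1 tT] _].
  have [Kt|_] := ltnP K t.
    by apply: pull_prob_le => //; rewrite Kt -ltnS.
  do 3! (rewrite addr_ge0 ?expR_ge0//; try by apply: sumr_ge0 => k _; exact: pr_ge0).
  apply: sumr_ge0 => i _; rewrite addr_ge0 ?expR_ge0//.
  apply: sumr_ge0 => k _; apply: sumr_ge0 => j _.
  by rewrite mulr_ge0 ?expR_ge0 ?pr_ge0.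
rewrite big_split/=; apply: lerD.
  rewrite exchange_big/=; apply: (@le_trans _ _ (\sum_(1 <= k < u.+1) (1 : R))).
    by apply: ler_sum => k _; exact: pull_count run ptheta a k.
  by rewrite sumr_const_nat subn1.
rewrite big_split/=; apply: lerD.
  rewrite exchange_big/=; apply: ler_sum => k _.
  have mB : measurable (`[m s1, +oo[%classic : set R) by exact: measurable_itv.
  apply: (pull_deviation run ptheta k ps1 mB) => y.
  rewrite /= in_itv/= andbT => s1y; apply: (le_trans xa).
  by rewrite -loglik_ratio_mean /loglik_ratio lerD2r ler_wpM2l// subr_ge0.
rewrite big_split/= sum_cst lerD2l.
rewrite exchange_big/=; apply: ler_sum => i _.
rewrite big_split/= sum_cst lerD2l.
rewrite exchange_big/=; apply: ler_sum => k _.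
rewrite exchange_big/=; apply: ler_sum => j _.
rewrite -mulr_sumr ler_wpM2l ?expR_ge0//.
have [mB _ [s' ps' hs']] := HB _ (lev0 i j).
exact: (pull_deviation run ptheta k ps').
Qed.

End arm_bound.

(** * Summation over counts, levels and blocks *)

Section numeric_bounds.
Context {R : realType}.
Implicit Types (x y s : R) (n T : nat).

Lemma sum_expRN_le x n : 0 < x -> \sum_(1 <= k < n.+1) expR (- (k%:R * x)) <= x^-1.
Proof.
move=> x0; suff: \sum_(1 <= k < n.+1) expR (- (k%:R * x)) <=
    x^-1 * (1 - expR (- (n%:R * x))).
  by move=> h; apply: (le_trans h); rewrite ger_pMr ?invr_gt0// gerBl expR_ge0.
elim: n => [|n IH]; first by rewrite big_geq// mul0r oppr0 expR0 subrr mulr0.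
rewrite big_nat_recr//= (le_trans (lerD IH (lexx _)))//.
rewrite addrC -lerBrDr -mulrBr ler_pdivlMl//.
have -> : expR (- (n%:R * x)) = expR (- (n.+1%:R * x)) * expR x.
  by rewrite -expRD -natr1; congr expR; ring.
have := expR_ge1Dx x; have : 0 < expR (- (n.+1%:R * x)) by exact: expR_gt0.
move: (expR _) (expR _) => e f *; nra.
Qed.

(** [1 + s^-2 <= (1 + s^-1)^2 <= expR (2 / s)]. The growth like [1 / s] near 0 is harmless once
    multiplied by the [s^2] of a block. *)
Lemma ln1Dinv_le s : 0 < s -> ln (1 + (s ^+ 2)^-1) <= 2 / s.
Proof.
move=> s0; have si0 : 0 < s^-1 by rewrite invr_gt0.
have -> : 2 / s = ln (expR s^-1 ^+ 2) by rewrite -expRM_natl expRK.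
rewrite ler_ln ?posrE ?exprn_gt0 ?expR_gt0//; last first.
  by rewrite ltr_wpDr// invr_ge0 sqr_ge0.
apply: (@le_trans _ _ ((1 + s^-1) ^+ 2)).
  by rewrite -exprVn; nra.
by rewrite ler_pXn2r ?nnegrE ?expR_ge0 ?addr_ge0 ?(ltW si0)// expR_ge1Dx.
Qed.

(* Up to a constant, the terms on the left telescope along the dyadic values of [s]. *)
Lemma dyadic_potential s : 0 < s ->
  (s ^+ 2 + s) * expR (- s ^+ 2) <= 8 * ((2 * s) / (1 + 2 * s) - s / (1 + s)).
Proof.
move=> s0.
have -> : 2 * s / (1 + 2 * s) - s / (1 + s) = s / ((1 + 2 * s) * (1 + s)).
  by field; apply/andP; split; rewrite gt_eqF//; lra.
rewrite mulrA ler_pdivlMr; last by rewrite mulr_gt0//; lra.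
rewrite expRN mulrAC ler_pdivrMr ?expR_gt0//.
have e1 : (1 + s ^+ 2 / 2) ^+ 2 <= expR (s ^+ 2).
  have -> : expR (s ^+ 2) = expR (s ^+ 2 / 2) ^+ 2.
    by rewrite -expRM_natl; congr expR; field.
  rewrite ler_pXn2r ?nnegrE ?expR_ge0 ?expR_ge1Dx//.
  by rewrite addr_ge0// divr_ge0// sqr_ge0.
apply: (@le_trans _ _ (8 * s * (1 + s ^+ 2 / 2) ^+ 2)); last first.
  by rewrite ler_pM2l// mulr_gt0.
rewrite -subr_ge0.
(* A sum of squares certificate; the factor 8 leaves the slack 5. *)
have -> : 8 * s * (1 + s ^+ 2 / 2) ^+ 2 - (s ^+ 2 + s) * ((1 + 2 * s) * (1 + s)) =
  s * (2 * (s - 1) ^+ 2 + s ^+ 2 * (s - 1) ^+ 2 + (s ^+ 2) ^+ 2 + 5) by field.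
apply: mulr_ge0; first exact: ltW.
have h1 := sqr_ge0 (s - 1); have h2 := sqr_ge0 (s ^+ 2).
have h3 := mulr_ge0 (sqr_ge0 s) h1.
by rewrite !addr_ge0// mulr_ge0.
Qed.

(** The potential [s / (1 + s)] stays in [[0, 1]], so the bound is uniform in the number of blocks
    and in the scale [s], which will be [Num.sqrt x] and depends on the gap. *)
Lemma sum_dyadic_le s n : 0 < s ->
  \sum_(0 <= i < n) ((2 ^+ i * s) ^+ 2 + 2 ^+ i * s) * expR (- (2 ^+ i * s) ^+ 2) <= 8.
Proof.
move=> s0; pose h i : R := (2 ^+ i * s) / (1 + 2 ^+ i * s).
have pos i : 0 < 2 ^+ i * s by rewrite mulr_gt0// exprn_gt0.
apply: (@le_trans _ _ (\sum_(0 <= i < n) 8 * (h i.+1 - h i))).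
  apply: ler_sum => i _; rewrite (le_trans (dyadic_potential (pos i)))//.
  by rewrite /h exprS mulrA.
rewrite -mulr_sumr telescope_sumr// ler_piMr// (@le_trans _ _ (h n))//.
  by rewrite gerBl /h divr_ge0 ?addr_ge0 ?(ltW (pos _)).
by rewrite /h ler_pdivrMr ?mul1r ?lerDr// addr_gt0.
Qed.

End numeric_bounds.

Section block_bound.
Context {R : realType}.
Variables (x : R) (T : nat).
Hypothesis x0 : 0 < x.
Let n i : R := (4 ^ i)%:R.
Let Lam := ln (1 + T%:R * x).
Let s i := 2 ^+ i * Num.sqrt x.
Let L i := ln (1 + T%:R / n i).
(** The least natural number above [ln (1 + T / 4^i)]: its exponential exceeds [T / 4^i], which is
    what the tail needs to absorb the factor [T]. *)
Definition levels i := (Num.truncn (ln (1 + T%:R / (4 ^ i)%:R) : R)).+1.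

Let n0 i : 0 < n i. Proof. by rewrite ltr0n expn_gt0. Qed.
Let s0 i : 0 < s i. Proof. by rewrite mulr_gt0 ?exprn_gt0// sqrtr_gt0. Qed.
Let sE i : s i ^+ 2 = n i * x.
Proof. by rewrite /s exprMn sqr_sqrtr ?(ltW x0)// exprAC /n natrX -(natrX _ 2 2). Qed.
Let Lam0 : 0 <= Lam. Proof. by rewrite ln_ge0// lerDl mulr_ge0// ltW. Qed.
Let L0 i : 0 <= L i. Proof. by rewrite ln_ge0// lerDl divr_ge0. Qed.

Lemma levels_le i : (levels i)%:R <= 1 + L i.
Proof. rewrite /levels -natr1 addrC lerD2l truncn_le; exact: L0. Qed.

Lemma levels_gt i : L i < (levels i)%:R.
Proof. exact: truncnS_gt. Qed.

(** [1 + T / n <= (1 + T * x) * (1 + 1 / (n * x))], with [n * x = s^2]: this replaces the logarithm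
    of the block by one common to all blocks. *)
Let L_le i : L i <= Lam + 2 / s i.
Proof.
apply: (@le_trans _ _ (Lam + ln (1 + (s i ^+ 2)^-1))); last first.
  by rewrite lerD2l ln1Dinv_le.
have p1 : 0 < 1 + T%:R * x by rewrite ltr_wpDr// mulr_ge0// ltW.
have p2 : 0 < 1 + (s i ^+ 2)^-1 by rewrite ltr_wpDr// invr_ge0 sqr_ge0.
have p3 : 0 < 1 + T%:R / n i by rewrite ltr_wpDr// divr_ge0.
rewrite -lnM ?posrE// ler_ln ?posrE ?mulr_gt0// sE.
have -> : (1 + T%:R * x) * (1 + (n i * x)^-1) =
  1 + T%:R / n i + (T%:R * x + (n i * x)^-1).
  by field; rewrite !gt_eqF.
by rewrite lerDl addr_ge0 ?mulr_ge0 ?invr_ge0 ?mulr_ge0 ?(ltW x0).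
Qed.

(** The two exponents differ by one level, that is by [k / 4^i < 4], which is the source of
    [expR 4]. The block contains [3 * 4^i] counts. *)
Lemma level_sum_le i :
  \sum_(4 ^ i <= k < 4 ^ i.+1) \sum_(0 <= j < levels i)
       expR (k%:R * (j.+1%:R / n i)) * expR (- (k%:R * (j%:R / n i + x)))
  <= 3 * expR 4 * (levels i)%:R * (n i * expR (- (n i * x))).
Proof.
apply: (@le_trans _ _ (\sum_(4 ^ i <= k < 4 ^ i.+1) \sum_(0 <= j < levels i)
   expR 4 * expR (- (n i * x)))).
  rewrite big_nat_cond [leRHS]big_nat_cond; apply: ler_sum => k /andP[/andP[nk kn] _].
  apply: ler_sum => j _; rewrite -!expRD ler_expR.
  have -> : k%:R * (j.+1%:R / n i) - k%:R * (j%:R / n i + x) = k%:R / n i - k%:R * x.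
    by rewrite -natr1; field; rewrite gt_eqF.
  apply: lerB; last by rewrite ler_wpM2r ?(ltW x0)// ler_nat.
  by rewrite ler_pdivrMr// -natrM ler_nat -expnS ltnW.
have cnt : (4 ^ i.+1 - 4 ^ i = 3 * 4 ^ i)%N.
  by rewrite expnS -[X in (_ - X)%N](mul1n (4 ^ i)%N) -mulnBl.
rewrite !sumr_const_nat subn0 cnt -(mulr_natr _ (3 * 4 ^ i)%N) -(mulr_natr _ (levels i)).
rewrite natrM -/(n i).
move: (expR _) (expR _) => e f; rewrite le_eqVlt; apply/orP; left; apply/eqP; ring.
Qed.

Lemma tail_le i : T%:R * expR (- (n i * ((levels i)%:R / n i + x))) <=
  n i * expR (- (n i * x)).
Proof.
have -> : n i * ((levels i)%:R / n i + x) = (levels i)%:R + n i * x.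
  by field; rewrite gt_eqF.
rewrite opprD expRD mulrA ler_pM2r ?expR_gt0//.
rewrite expRN ler_pdivrMr ?expR_gt0//.
have p3 : 0 < 1 + T%:R / n i by rewrite ltr_wpDr// divr_ge0.
apply: (@le_trans _ _ (n i * (1 + T%:R / n i))).
  by rewrite mulrDr mulr1 mulrC divfK ?gt_eqF// lerDr ltW.
rewrite ler_pM2l// -[leLHS](lnK (_ : _ \in Num.pos)) ?posrE// ler_expR.
by rewrite ltW// levels_gt.
Qed.

(** With [n = s^2 / x] and at most [1 + Lam + 2 / s] levels, the product of [n] and the number of
    levels is at most [2 * (1 + Lam) / x * (s^2 + s)], in the form summed by [sum_dyadic_le]. *)
Lemma block_le i :
  T%:R * expR (- (n i * ((levels i)%:R / n i + x))) +
  \sum_(4 ^ i <= k < 4 ^ i.+1) \sum_(0 <= j < levels i)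
       expR (k%:R * (j.+1%:R / n i)) * expR (- (k%:R * (j%:R / n i + x)))
  <= 2 * (1 + 3 * expR 4) * ((1 + Lam) / x) *
     ((s i ^+ 2 + s i) * expR (- s i ^+ 2)).
Proof.
apply: (le_trans (lerD (tail_le i) (level_sum_le i))).
have J1 : 1 <= (levels i)%:R :> R by rewrite ler1n.
have -> : n i = s i ^+ 2 / x by rewrite sE mulfK// gt_eqF.
rewrite mulfVK ?gt_eqF//.
have JL : (levels i)%:R <= 1 + Lam + 2 / s i.
  by rewrite (le_trans (levels_le i))// -addrA lerD2l L_le.
have e40 : 0 < expR 4 :> R by exact: expR_gt0.
have es0 : 0 < expR (- s i ^+ 2) by exact: expR_gt0.
have si0 := s0 i; have xV0 : 0 < x^-1 by rewrite invr_gt0.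
apply: (@le_trans _ _ ((1 + 3 * expR 4) * (s i ^+ 2 * (levels i)%:R) *
    (expR (- s i ^+ 2) / x))).
  rewrite -subr_ge0.
  have -> : (1 + 3 * expR 4) * (s i ^+ 2 * (levels i)%:R) * (expR (- s i ^+ 2) / x) -
   (s i ^+ 2 / x * expR (- s i ^+ 2) +
    3 * expR 4 * (levels i)%:R * (s i ^+ 2 / x * expR (- s i ^+ 2))) =
   s i ^+ 2 * (expR (- s i ^+ 2) * x^-1) * ((levels i)%:R - 1).
    by move: (expR _) (expR _) x^-1 (levels i)%:R => *; ring.
  by rewrite mulr_ge0 ?subr_ge0// mulr_ge0 ?sqr_ge0// mulr_ge0// ltW.
have -> : 2 * (1 + 3 * expR 4) * ((1 + Lam) / x) *
    ((s i ^+ 2 + s i) * expR (- s i ^+ 2)) =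
    (1 + 3 * expR 4) * (2 * (1 + Lam) * (s i ^+ 2 + s i)) * (expR (- s i ^+ 2) / x).
  by move: (expR _) (expR _) x^-1 => *; ring.
rewrite ler_wpM2r ?mulr_ge0 ?(ltW es0) ?(ltW xV0)//.
apply: ler_wpM2l; first by rewrite addr_ge0// mulr_ge0// ltW.
apply: (@le_trans _ _ (s i ^+ 2 * (1 + Lam + 2 / s i))).
  by rewrite ler_wpM2l ?sqr_ge0.
have -> : s i ^+ 2 * (1 + Lam + 2 / s i) = s i ^+ 2 * (1 + Lam) + 2 * s i.
  by field; rewrite gt_eqF.
move: (s i) (Lam) si0 Lam0 => z l z0 l0.
have : 0 <= z ^+ 2 * (1 + l) by rewrite mulr_ge0 ?sqr_ge0// addr_ge0.
have : 0 <= z * l by rewrite mulr_ge0// ltW.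
lra.
Qed.

(** The number [u] exceeds [Lam / x], so [T * expR (- (u * x))] is at most
    [T / (1 + T * x) <= 1 / x]. The blocks give [8 * 2 * (1 + 3 * expR 4) = 16 + 48 * expR 4]; the
    other 3 covers [u], the geometric sum and this term. *)
Lemma pull_sum_bound (u := (Num.truncn (Lam / x)).+1) :
  u%:R + (\sum_(1 <= k < T.+1) expR (- (k%:R * x)) +
  (T%:R * expR (- (u%:R * x)) +
   \sum_(0 <= i < T) (T%:R * expR (- (n i * ((levels i)%:R / n i + x))) +
     \sum_(4 ^ i <= k < 4 ^ i.+1) \sum_(0 <= j < levels i)
       expR (k%:R * (j.+1%:R / n i)) *
       expR (- (k%:R * (j%:R / n i + x)))))) <=
  1 + (19 + 48 * expR 4) * ((1 + Lam) / x).
Proof.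
have xV0 : 0 < x^-1 by rewrite invr_gt0.
have u1 : u%:R <= 1 + Lam / x.
  by rewrite /u -natr1 addrC lerD2l truncn_le divr_ge0 ?(ltW x0).
have u2 : Lam / x < u%:R by rewrite /u truncnS_gt.
have u3 : T%:R * expR (- (u%:R * x)) <= x^-1.
  apply: (@le_trans _ _ (T%:R / (1 + T%:R * x))).
    rewrite ler_wpM2l// expRN lef_pV2 ?posrE ?expR_gt0 ?ltr_wpDr ?mulr_ge0 ?(ltW x0)//.
    rewrite -[leLHS](lnK (_ : _ \in Num.pos)) ?posrE ?ltr_wpDr ?mulr_ge0 ?(ltW x0)//.
    by rewrite ler_expR -ler_pdivrMr// ltW.
  rewrite ler_pdivrMr ?ltr_wpDr ?mulr_ge0 ?(ltW x0)//.
  by rewrite mulrDr mulr1 mulrCA mulVf ?gt_eqF// mulr1 lerDr ltW.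
have blocks := ler_sum (index_iota 0 T) (fun i (_ : xpredT i) => block_le i).
have sd := sum_dyadic_le T (s0 0%N).
rewrite -mulr_sumr in blocks.
have sEq : \sum_(0 <= i < T) ((s i ^+ 2 + s i) * expR (- s i ^+ 2)) <= 8.
  apply: le_trans sd; rewrite /s expr0 mul1r.
  by rewrite le_eqVlt; apply/orP; left; apply/eqP; apply: eq_bigr.
have e40 : 0 < expR 4 :> R by exact: expR_gt0.
have Lx : 0 <= Lam / x by rewrite divr_ge0 ?(ltW x0).
have bb : 2 * (1 + 3 * expR 4) * ((1 + Lam) / x) *
    (\sum_(0 <= i < T) ((s i ^+ 2 + s i) * expR (- s i ^+ 2))) <=
    2 * (1 + 3 * expR 4) * ((1 + Lam) / x) * 8.
  apply: ler_wpM2l => //; apply: mulr_ge0.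
    by rewrite mulr_ge0// addr_ge0// mulr_ge0// ltW.
  by rewrite divr_ge0 ?addr_ge0 ?(ltW x0).
have se := sum_expRN_le T x0.
apply: (le_trans (lerD u1 (lerD se (lerD u3 (le_trans blocks bb))))).
have -> : (1 + Lam) / x = x^-1 + Lam / x by rewrite mulrDl mul1r.
move: (Lam / x) (x^-1) (expR 4) Lx xV0 e40 => l v e l0 v0 e0.
have := mulr_ge0 (ltW e0) l0; have := mulr_ge0 (ltW e0) (ltW v0).
lra.
Qed.

End block_bound.

(** * Regret *)

Section regret_arithmetic.
Context {R : realType}.
Variables (C_L M V : R) (K T : nat).
Hypotheses (CL0 : 0 < C_L) (M0 : 0 < M) (V0 : 0 <= V) (K2 : (2 <= K)%N) (T2 : (2 <= T)%N).

Definition gap_rate (D : R) : R := D ^+ 2 / (18 * (V + C_L * D)).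
Definition main_term : R := Num.sqrt (V * K%:R * T%:R * ln K%:R).
Definition gap_threshold : R := main_term / T%:R.

Let ln2 : 0 < ln (2 : R). Proof. by rewrite ln_gt0// ltr1n. Qed.
Let K0 : 0 < K%:R :> R. Proof. by rewrite ltr0n ltnW. Qed.
Let T0 : 0 < T%:R :> R. Proof. by rewrite ltr0n ltnW. Qed.
Let le_lnK : ln 2 <= ln K%:R :> R. Proof. by rewrite ler_ln ?posrE// ler_nat. Qed.
Let le_lnT : ln 2 <= ln T%:R :> R. Proof. by rewrite ler_ln ?posrE// ler_nat. Qed.

(** Absorbs additive constants into [ln K] or [ln T], both at least [ln 2]. *)
Lemma le_ln2_div (c n : R) : 0 <= c -> ln 2 <= n -> c <= c / ln 2 * n.
Proof.
move=> c0 h; rewrite mulrAC ler_pdivlMr//; exact: ler_wpM2l.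
Qed.

Lemma gap_rate_le1 D : 0 < D -> D <= M -> gap_rate D <= M / (18 * C_L).
Proof.
move=> D0 DM; have W0 : 0 < V + C_L * D by rewrite ltr_wpDl// mulr_gt0.
rewrite /gap_rate ler_pdivrMr ?mulr_gt0// mulrAC ler_pdivlMr ?mulr_gt0//.
have : 0 <= M * V by rewrite mulr_ge0// ltW.
have : 0 <= C_L * D * (M - D) by rewrite mulr_ge0 ?subr_ge0// mulr_ge0 ?ltW.
nra.
Qed.

Let gap_rate_gt0 D : 0 < D -> 0 < gap_rate D.
Proof.
by move=> D0; rewrite divr_gt0 ?exprn_gt0// mulr_gt0// ltr_wpDl// mulr_gt0.
Qed.

(** Dropping [V] from the denominator bounds the rate by [M / (18 * C_L)], so the constant depends
    on [C_L] and [M] only. *)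
Lemma log_gap_rate_le D : 0 < D -> D <= M ->
  1 + ln (1 + T%:R * gap_rate D) <=
  (1 + (1 + ln (1 + M / (18 * C_L))) / ln 2) * ln T%:R.
Proof.
move=> D0 DM; have g0 := gap_rate_gt0 D0; set mu := M / (18 * C_L).
have mu0 : 0 < mu by rewrite divr_gt0// mulr_gt0.
have h : ln (1 + T%:R * gap_rate D) <= ln T%:R + ln (1 + mu).
  rewrite -lnM ?posrE// ?ltr_wpDr ?(ltW mu0)// ler_ln ?posrE; last 2 first.
  - by rewrite ltr_wpDr// mulr_ge0// ltW.
  - by rewrite mulr_gt0// ltr_wpDr// ltW.
  rewrite mulrDr mulr1 lerD//; first by rewrite ler1n ltnW.
  by rewrite ler_wpM2l ?(ltW T0)// gap_rate_le1.
have c0 : 0 <= 1 + ln (1 + mu) by rewrite addr_ge0// ln_ge0// lerDl ltW.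
have := le_ln2_div c0 le_lnT.
rewrite mulrDl mul1r; move: h; move: (ln (1 + mu) : R) (ln (1 + T%:R * _)) => *; lra.
Qed.

Lemma main_termE : main_term ^+ 2 = V * K%:R * T%:R * ln K%:R.
Proof.
rewrite sqr_sqrtr// !mulr_ge0 ?(ltW K0) ?(ltW T0)//.
by rewrite ltW// (lt_le_trans ln2 le_lnK).
Qed.

(** At the threshold [D0] one has [T * D0^2 / V = K * ln K]. For larger [D] the logarithm grows by
    at most [2 * ln (D / D0) <= 2 * D / D0], which the prefactor [V / D] compensates; finally
    [V / D0 * ln K] is [main_term / K]. *)
Lemma log_gap_rate_large D : gap_threshold < D ->
  V / D * (1 + ln (1 + T%:R * gap_rate D)) <= (3 + 3 / ln 2) * (main_term / K%:R).
Proof.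
have lnK0 : 0 < ln K%:R :> R by exact: lt_le_trans le_lnK.
have S0 : 0 <= main_term by exact: sqrtr_ge0.
(* For [V = 0] the threshold vanishes and could not be divided by; the left-hand side is 0. *)
have [->|Vn0] := eqVneq V 0.
  move=> _; rewrite !mul0r mulr_ge0// ?divr_ge0// ?(ltW K0)//.
  by rewrite addr_ge0// divr_ge0// ltW.
have Vp : 0 < V by rewrite lt_def Vn0.
have Sp : 0 < main_term by rewrite sqrtr_gt0 !mulr_gt0.
have D00 : 0 < gap_threshold by rewrite divr_gt0.
move=> D0D; have Dp : 0 < D by exact: lt_trans D0D.
have g0 := gap_rate_gt0 Dp.
set D0 := gap_threshold in D00 D0D *.
have Kx : T%:R * (D0 ^+ 2 / V) = K%:R * ln K%:R.
  rewrite /D0 /gap_threshold exprMn main_termE; field.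
  by rewrite !gt_eqF.
have rD : 1 <= D / D0 by rewrite ler_pdivlMr// mul1r ltW.
have pA : 0 < 1 + T%:R * gap_rate D by rewrite ltr_wpDr// mulr_ge0// ltW.
have pB : 0 < 1 + K%:R * ln K%:R :> R by rewrite ltr_wpDr// mulr_ge0// ltW.
have D0V : 0 < D0^-1 by rewrite invr_gt0.
have h1 : ln (1 + T%:R * gap_rate D) <= ln (1 + K%:R * ln K%:R) + 2 * ln (D / D0).
  have -> : 2 * ln (D / D0) = ln ((D / D0) ^+ 2).
    by rewrite lnXn ?divr_gt0// mulr_natl.
  rewrite -lnM ?posrE ?exprn_gt0 ?divr_gt0//.
  rewrite ler_ln ?posrE ?mulr_gt0 ?exprn_gt0 ?divr_gt0//.
  rewrite mulrDl mul1r lerD//; first by rewrite expr_ge1 ?(le_trans _ rD).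
  rewrite -Kx.
  have -> : T%:R * (D0 ^+ 2 / V) * (D / D0) ^+ 2 = T%:R * (D ^+ 2 / V).
    by field; rewrite !gt_eqF.
  rewrite ler_wpM2l ?(ltW T0)//.
  rewrite /gap_rate ler_wpM2l ?sqr_ge0// lef_pV2 ?posrE// ?mulr_gt0//; last first.
    by rewrite ltr_wpDl// mulr_gt0.
  have : 0 < C_L * D by rewrite mulr_gt0.
  move: (C_L * D) => z; lra.
have h2 : ln (D / D0) <= D / D0.
  by rewrite -ler_expR lnK ?posrE ?divr_gt0//; have := expR_ge1Dx (D / D0); lra.
have h3 : ln (1 + K%:R * ln K%:R) <= 3 * ln K%:R :> R.
  have -> : 3 * ln K%:R = ln (K%:R ^+ 3) :> R by rewrite lnXn// mulr_natl.
  rewrite ler_ln ?posrE ?exprn_gt0//.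
  have lK : ln K%:R <= K%:R :> R.
    by rewrite -ler_expR lnK ?posrE//; have := expR_ge1Dx (K%:R : R); lra.
  have K2' : 2 <= K%:R :> R by rewrite ler_nat.
  have : K%:R * ln K%:R <= K%:R * K%:R :> R by rewrite ler_wpM2l ?(ltW K0).
  move: (ln K%:R : R) (K%:R : R) K2' => l k k2; nra.
have h4 : V / D * ln (D / D0) <= V / D0.
  apply: (@le_trans _ _ (V / D * (D / D0))).
    by rewrite ler_wpM2l ?divr_ge0 ?(ltW Vp) ?(ltW Dp).
  by rewrite mulrA mulfVK ?gt_eqF.
have h5 : V / D <= V / D0.
  by rewrite ler_wpM2l ?(ltW Vp)// lef_pV2 ?posrE// ltW.
have h6 : 0 <= ln (1 + K%:R * ln K%:R) :> R.
  by rewrite ln_ge0// lerDl mulr_ge0// ltW.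
have h7 : V / D * (1 + ln (1 + T%:R * gap_rate D)) <= V / D0 * (3 + 3 * ln K%:R).
  apply: (@le_trans _ _ (V / D * (1 + (ln (1 + K%:R * ln K%:R) + 2 * ln (D / D0))))).
    apply: ler_wpM2l; first by rewrite divr_ge0 ?(ltW Vp) ?(ltW Dp).
    by rewrite lerD2l.
  have h8 : V / D * (1 + ln (1 + K%:R * ln K%:R)) <= V / D0 * (1 + 3 * ln K%:R).
    apply: ler_pM => //; last by rewrite lerD2l.
      by rewrite divr_ge0 ?(ltW Vp) ?(ltW Dp).
    by rewrite addr_ge0.
  move: h4 h8; move: (V / D) (V / D0) (ln (D / D0) : R) (ln (1 + _) : R) (ln _ : R) => *; lra.
apply: (le_trans h7).
have h9 : V / D0 * ln K%:R = main_term / K%:R.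
  rewrite /D0 /gap_threshold.
  have := main_termE; move: main_term Sp => S Sp eS.
  apply: (mulIf (_ : S != 0)); first by rewrite gt_eqF.
  rewrite mulrAC -[RHS]mulrAC -expr2 eS; field.
  by rewrite !gt_eqF.
rewrite -h9 mulrCA ler_wpM2l ?divr_ge0 ?(ltW Vp) ?(ltW D00)//.
have h10 : (3 : R) <= 3 / ln 2 * ln K%:R by exact: le_ln2_div.
rewrite mulrDl addrC; lra.
Qed.

(** [D / gap_rate D = 18 * (V / D + C_L)]: the first summand produces the square root term, the
    second the term in [ln T]. *)
Lemma gap_regret_le c D : 0 <= c -> gap_threshold < D -> D <= M ->
  D * (1 + c * ((1 + ln (1 + T%:R * gap_rate D)) / gap_rate D)) <=
  M + 18 * c * ((3 + 3 / ln 2) * (main_term / K%:R) +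
    C_L * ((1 + (1 + ln (1 + M / (18 * C_L))) / ln 2) * ln T%:R)).
Proof.
move=> c0 D0D DM.
have Dp : 0 < D by apply: le_lt_trans D0D; rewrite divr_ge0 ?sqrtr_ge0// ltW.
have h1 := log_gap_rate_le Dp DM; have h2 := log_gap_rate_large D0D.
have W0 : 0 < V + C_L * D by rewrite ltr_wpDl// mulr_gt0.
set l := 1 + ln (1 + _) in h1 h2 *.
have e : D * (1 + c * (l / gap_rate D)) = D + 18 * c * (V / D * l + C_L * l).
  by rewrite /gap_rate; field; rewrite !gt_eqF.
rewrite e lerD// ler_wpM2l ?mulr_ge0// lerD// ler_wpM2l// ltW//.
Qed.

End regret_arithmetic.

Section regret_decomposition.
Context (R : realType) (K : nat) (d : measure_display) (Om : measurableType d).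
Variables (P : probability Om R) (I : nat -> Om -> 'I_K) (T : nat).
Hypothesis mI : forall t a, (1 <= t <= T)%N -> measurable (I t @^-1` [set a]).

Lemma arm_value (f : 'I_K -> R) t w :
  f (I t w) = \sum_a f a * \1_(I t @^-1` [set a]) w.
Proof.
rewrite (bigD1 (I t w))//= indicE mem_set// mulr1 big1 ?addr0// => a aI.
by rewrite indicE memNset ?mulr0// => /= e; rewrite e eqxx in aI.
Qed.

Lemma measurable_arm_value (f : 'I_K -> R) t : (1 <= t <= T)%N ->
  measurable_fun setT (fun w => f (I t w)).
Proof.
move=> tT; rewrite (funext (arm_value f t)).
apply: measurable_sum => a; apply: measurable_funM => //.
by apply: measurable_indic; exact: mI.
Qed.

Lemma integral_arm_value (f : 'I_K -> R) t : (1 <= t <= T)%N -> (forall a, 0 <= f a) ->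
  (\int[P]_w (f (I t w))%:E = (\sum_a f a * pr P (I t @^-1` [set a]))%:E)%E.
Proof.
move=> tT f0.
under eq_integral do rewrite arm_value -sumEFin.
have mi a : measurable_fun setT (fun w => (f a * \1_(I t @^-1` [set a]) w)%:E).
  apply/measurable_EFinP; apply: measurable_funM => //.
  by apply: measurable_indic; exact: mI.
rewrite ge0_integral_sum//; last by move=> a w _; rewrite lee_fin mulr_ge0.
rewrite -sumEFin; apply: eq_bigr => a _.
under eq_integral do rewrite EFinM.
rewrite ge0_integralZl//; last 2 first.
- by apply/measurable_EFinP; apply: measurable_indic; exact: mI.
- by rewrite lee_fin.
rewrite integral_indic//; last exact: mI.
by rewrite setIT EFinM -prE//; exact: mI.
Qed.

Lemma sum_pr_arm t : (1 <= t <= T)%N -> \sum_a pr P (I t @^-1` [set a]) = 1.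
Proof.
move=> tT; have := @integral_arm_value (fun=> 1) t tT (fun _ => ler01).
have := expectation_cst P (1 : R); rewrite unlock => -> [->].
by apply: eq_bigr => a _; rewrite mul1r.
Qed.

Lemma regretE (mu : 'I_K -> R) : regret I P mu T =
  (\sum_(1 <= t < T.+1) \sum_a (max_arm mu - mu a) * pr P (I t @^-1` [set a]))%:E.
Proof.
have D0 a : 0 <= max_arm mu - mu a by rewrite subr_ge0 max_arm_ge.
rewrite /regret unlock.
(* Arms are known to be measurable only in rounds 1 to [T], whereas exchanging sum and integral asks
   for measurability at every index; hence the cut-off. *)
pose g (t : nat) w : R :=
  if (1 <= t <= T)%N then max_arm mu - mu (I t w) else 0.
transitivity (\int[P]_w (\sum_(1 <= t < T.+1) (g t w)%:E))%E.
  apply: eq_integral => w _; rewrite -sumEFin big_nat_cond [RHS]big_nat_cond.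
  by apply: eq_bigr => t; rewrite andbT ltnS /g => ->.
have mg t : measurable_fun setT (g t).
  have [tT|tT] := boolP (1 <= t <= T)%N; last first.
    by rewrite (_ : g t = cst 0)//; apply/funext => w; rewrite /g (negbTE tT).
  rewrite (_ : g t = fun w => max_arm mu - mu (I t w)).
    exact: (@measurable_arm_value (fun a => max_arm mu - mu a)).
  by apply/funext => w; rewrite /g tT.
rewrite ge0_integral_sum//; last 2 first.
- by move=> t; exact/measurable_EFinP/mg.
- by move=> t w _; rewrite lee_fin /g; case: ifP => // _; rewrite subr_ge0 max_arm_ge.
rewrite -sumEFin big_nat_cond [RHS]big_nat_cond; apply: eq_bigr => t.
rewrite andbT ltnS => tT; rewrite /g tT.
exact: (@integral_arm_value (fun a => max_arm mu - mu a)).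
Qed.

End regret_decomposition.

Section gap_pulls.
Context (R : realType) (F : exp_family R) (K : nat).
Context (d : measure_display) (Om : measurableType d) (P : probability Om R).
Variables (I : nat -> Om -> 'I_K) (r : nat -> Om -> R).
Variables (theta : 'I_K -> R) (T : nat) (C_L M : R).
Hypothesis run : exp_kl_ms_run F I r P (fun a => member F (theta a)) T.
Hypotheses (K0 : (0 < K)%N) (CL0 : 0 < C_L).
Hypothesis regF : regular_log_partition F.
Hypothesis lipF : lipschitz_variance F C_L M.
Hypothesis btheta : forall a, bounded_params F M (theta a).
Local Notation m := (mean F).

Lemma variance_fun_ge0 mu : 0 <= variance_fun F mu.
Proof. by rewrite /variance_fun fine_ge0// variance_ge0. Qed.

Lemma gap_pulls_le a o (D := m (theta o) - m (theta a))
    (x := gap_rate C_L (variance_fun F (m (theta o))) D) : 0 < D ->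
  \sum_(1 <= t < T.+1 | (K < t)%N) pr P (I t @^-1` [set a]) <=
  1 + (19 + 48 * expR 4) * ((1 + ln (1 + T%:R * x)) / x).
Proof.
move=> D0.
have [pa /andP[ma0 maM]] := btheta a; have [po /andP[mo0 moM]] := btheta o.
have ptheta i : params F (theta i) by have [] := btheta i.
have mao : m (theta a) < m (theta o) by rewrite -subr_gt0.
have params2 : exists s t, [/\ params F s, params F t & s < t].
  have [ao|oa|e] := ltgtP (theta a) (theta o).
  - by exists (theta a), (theta o).
  - by exists (theta o), (theta a).
  - by move: mao; rewrite e ltxx.
have ao := mean_lt_inv regF params2 pa po mao.
set V := variance_fun F (m (theta o)) in x *.
have V0 : 0 <= V by exact: variance_fun_ge0.
pose W := V + C_L * D.
have W0 : 0 < W by rewrite ltr_wpDl// mulr_gt0.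
have DE : m (theta o) = m (theta a) + D by rewrite /D addrC subrK.
have [|s1 /andP[as1 s1o] ms1] := mean_IVT regF params2 pa po (ltW ao)
    (v := m (theta a) + D / 3).
  by rewrite DE; apply/andP; split; lra.
have [|s2 /andP[as2 s2o] ms2] := mean_IVT regF params2 pa po (ltW ao)
    (v := m (theta o) - D / 3).
  by rewrite DE; apply/andP; split; lra.
have ps1 : params F s1 by apply: (params_between pa po); rewrite as1.
have ps2 : params F s2 by apply: (params_between pa po); rewrite as2.
have s12 : s1 <= s2.
  by apply: (mean_le_inv regF params2) => //; rewrite ms1 ms2 DE; lra.
(* Monotonicity of the mean keeps [m u] between the means of the two arms, hence in []0, M]], where
   the Lipschitz bound applies. *)
have VW u : theta a <= u <= theta o -> variance_fun F (m u) <= W.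
  move=> au; have pu := params_between pa po au.
  have /andP[au1 uo1] := au.
  have m1 := mean_le regF params2 pa pu au1; have m2 := mean_le regF params2 pu po uo1.
  have mu : 0 < m u <= M by rewrite (lt_le_trans ma0 m1) (le_trans m2 moM).
  have mo : 0 < m (theta o) <= M by rewrite mo0 moM.
  have hm s : params F s -> means F (m s) by exists s.
  have := lipF (hm _ pu) (hm _ po) mu mo.
  move=> /(le_trans (ler_norm _)); rewrite lerBlDl => /le_trans; apply.
  rewrite lerD2l ler_wpM2l ?(ltW CL0)// distrC ger0_norm ?subr_ge0//.
  by rewrite /D lerD2l lerN2.
(* All three pairs have means at distance [D / 3], and [(D / 3)^2 / (2 * W)] is exactly [x]. *)
have quad s t : theta a <= s <= theta o -> theta a <= t <= theta o ->
    (m s - m t) ^+ 2 = (D / 3) ^+ 2 -> x <= kl_params F s t.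
  move=> sb tb e.
  have ps := params_between pa po sb; have pt := params_between pa po tb.
  apply: le_trans (kl_quadratic regF params2 ps pt W0 _).
    rewrite e le_eqVlt; apply/orP; left; apply/eqP; rewrite /x /gap_rate -/W.
    by field; rewrite gt_eqF.
  move=> u /andP[u1 u2]; apply: VW; move: u1 u2.
  rewrite gt_min lt_max => /orP h1 /orP h2.
  move: sb tb => /andP[sb1 sb2] /andP[tb1 tb2]; apply/andP; split.
    by case: h1 => h; [exact: le_trans sb1 (ltW h)|exact: le_trans tb1 (ltW h)].
  by case: h2 => h; [exact: le_trans (ltW h) sb2|exact: le_trans (ltW h) tb2].
have aa : theta a <= theta a <= theta o by rewrite lexx ltW.
have oo : theta a <= theta o <= theta o by rewrite lexx ltW.
have b1 : theta a <= s1 <= theta o by rewrite as1.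
have b2 : theta a <= s2 <= theta o by rewrite as2.
have x0 : 0 < x by rewrite divr_gt0 ?exprn_gt0// mulr_gt0.
have xa : x <= kl_params F s1 (theta a).
  by apply: quad => //; rewrite ms1 addrAC subrr add0r.
have x12 : x <= kl_params F s1 s2.
  apply: quad => //; rewrite ms1 ms2 DE -sqrrN; congr (_ ^+ 2); lra.
have xo : x <= kl_params F s2 (theta o).
  by apply: quad => //; rewrite ms2 addrAC subrr add0r sqrrN.
apply: le_trans (pull_sum_bound T x0).
exact: (sum_pull_prob_le run K0 ptheta regF params2 ps1 ps2 as1 s12 s2o
  (ltW x0) xa x12 xo).
Qed.

End gap_pulls.

Lemma sum_initial_rounds (R : realType) (M : R) (K n : nat) : 0 <= M ->
  \sum_(1 <= t < n.+1 | ~~ (K < t)%N) M <= K%:R * M.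
Proof.
move=> M0; suff -> : \sum_(1 <= t < n.+1 | ~~ (K < t)%N) M = (minn n K)%:R * M.
  by rewrite ler_wpM2r// ler_nat geq_minr.
elim: n => [|n IH]; first by rewrite big_geq// min0n mul0r.
rewrite big_mkcond big_nat_recr//= -big_mkcond/= IH -leqNgt.
have [nK|Kn] := ltnP n K.
  by rewrite (minn_idPl nK) -natr1 mulrDl mul1r.
by rewrite addr0 (minn_idPr _)// (leq_trans Kn).
Qed.

Section total_regret.
Context (R : realType) (C_L M V : R) (K T : nat).
Hypotheses (CL0 : 0 < C_L) (M0 : 0 < M) (V0 : 0 <= V) (K2 : (2 <= K)%N) (T2 : (2 <= T)%N).
Variables (p : nat -> 'I_K -> R) (D : 'I_K -> R) (c : R).
Hypotheses (p0 : forall t a, 0 <= p t a)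
  (p1 : forall t, (1 <= t <= T)%N -> \sum_a p t a = 1)
  (D0 : forall a, 0 <= D a) (DM : forall a, D a <= M) (c0 : 0 <= c).
Hypothesis pulls_le : forall a, 0 < D a ->
  \sum_(1 <= t < T.+1 | (K < t)%N) p t a <=
  1 + c * ((1 + ln (1 + T%:R * gap_rate C_L V (D a))) / gap_rate C_L V (D a)).

(** Purely numerical, with [p t a] in the role of the probability of pulling [a] in round [t]. The 2
    in [2 * M / ln 2] counts one [M] per arm from the additive term of [gap_regret_le] and one from
    the first [K] rounds. *)
Lemma sum_regret_le :
  \sum_(1 <= t < T.+1) \sum_a D a * p t a <=
  (1 + 18 * c * (3 + 3 / ln 2) + (2 * M / ln 2 +
    18 * c * C_L * (1 + (1 + ln (1 + M / (18 * C_L))) / ln 2))) *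
  (main_term V K T + K%:R * ln T%:R).
Proof.
set c3 := 3 + 3 / ln 2; set c4 := 1 + _ / ln 2.
set S := main_term V K T.
have ln2 : 0 < ln (2 : R) by rewrite ln_gt0// ltr1n.
have lnT2 : ln 2 <= ln T%:R :> R by rewrite ler_ln ?posrE ?ltr0n ?ler_nat// ltnW.
have T0 : 0 < T%:R :> R by rewrite ltr0n ltnW.
have K0 : 0 < K%:R :> R by rewrite ltr0n ltnW.
have S0 : 0 <= S by exact: sqrtr_ge0.
have c30 : 0 <= c3 by rewrite addr_ge0// divr_ge0// ltW.
have c40 : 0 <= c4.
  rewrite addr_ge0// divr_ge0 ?(ltW ln2)// addr_ge0// ln_ge0// lerDl.
  by rewrite divr_ge0 ?(ltW M0)// mulr_ge0 ?(ltW CL0).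
pose n a := \sum_(1 <= t < T.+1 | (K < t)%N) p t a.
have n0 a : 0 <= n a by apply: sumr_ge0.
pose B := M + 18 * c * (c3 * (S / K%:R) + C_L * (c4 * ln T%:R)).
have B0 : 0 <= B.
  rewrite addr_ge0 ?(ltW M0)// mulr_ge0 ?mulr_ge0// addr_ge0//.
    by rewrite mulr_ge0// divr_ge0// ltW.
  by rewrite mulr_ge0 ?(ltW CL0)// mulr_ge0// ltW// (lt_le_trans ln2).
(* Adding the costs of both cases for every arm avoids splitting the set of arms. The first summands
   total at most [main_term], because the [n a] sum to at most [T]. *)
have arm a : D a * n a <= gap_threshold V K T * n a + B.
  have [small|large] := leP (D a) (gap_threshold V K T).
    by rewrite -[leLHS]addr0 lerD// ler_wpM2r.
  have Da : 0 < D a by apply: le_lt_trans large; rewrite divr_ge0// ltW.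
  apply: (@le_trans _ _ B); last by rewrite lerDr mulr_ge0// divr_ge0// ltW.
  apply: le_trans (gap_regret_le CL0 M0 V0 K2 T2 c0 large (DM a)).
  by rewrite ler_wpM2l// pulls_le.
have sum_n : \sum_a n a <= T%:R.
  rewrite exchange_big/= big_mkcond big_nat_cond.
  apply: (@le_trans _ _ (\sum_(1 <= t < T.+1) (1 : R))).
    rewrite [leRHS]big_nat_cond; apply: ler_sum => t /andP[tT _].
    by case: ifP => // _; rewrite p1.
  by rewrite sumr_const_nat subn1.
have late : \sum_(1 <= t < T.+1 | (K < t)%N) \sum_a D a * p t a <= S + K%:R * B.
  rewrite exchange_big/=.
  under eq_bigr do rewrite -mulr_sumr.
  apply: (le_trans (ler_sum _ (fun a _ => arm a))).
  rewrite big_split/= -mulr_sumr sumr_const card_ord mulr_natl lerD2r.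
  apply: (@le_trans _ _ (gap_threshold V K T * T%:R)).
    by rewrite ler_wpM2l// divr_ge0// ltW.
  by rewrite /gap_threshold divfK// gt_eqF.
have early : \sum_(1 <= t < T.+1 | ~~ (K < t)%N) \sum_a D a * p t a <= K%:R * M.
  apply: le_trans (sum_initial_rounds K T (ltW M0)).
  rewrite big_nat_cond [leRHS]big_nat_cond; apply: ler_sum => t /andP[tT _].
  rewrite -[leRHS]mulr1 -(p1 tT) mulr_sumr; apply: ler_sum => a _.
  by rewrite ler_wpM2r.
rewrite (bigID (fun t => (K < t)%N))/= (le_trans (lerD late early))//.
have lnT0 : 0 < ln T%:R :> R by exact: lt_le_trans lnT2.
have M1 : M <= M / ln 2 * ln T%:R by exact: le_ln2_div (ltW M0) lnT2.
have e : K%:R * B = K%:R * M + 18 * c * c3 * S + 18 * c * C_L * c4 * (K%:R * ln T%:R).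
  by rewrite /B; field; rewrite gt_eqF.
rewrite e.
have KM : K%:R * M <= M / ln 2 * (K%:R * ln T%:R).
  by rewrite mulrCA ler_wpM2l ?(ltW K0).
have q1 : 0 <= 18 * c * c3 by rewrite mulr_ge0// mulr_ge0.
have q2 : 0 <= 18 * c * C_L * c4.
  by rewrite mulr_ge0// mulr_ge0 ?(ltW CL0)// mulr_ge0.
have q3 : 0 <= 2 * M / ln 2 by rewrite divr_ge0 ?(ltW ln2)// mulr_ge0// ltW.
have L0 : 0 <= K%:R * ln T%:R :> R by rewrite mulr_ge0// ltW.
have f1 := mulr_ge0 (addr_ge0 (ler01 : (0 : R) <= 1) q1) L0.
have f2 := mulr_ge0 (addr_ge0 q3 q2) S0.
have dM : 2 * M / ln 2 = M / ln 2 + M / ln 2 by rewrite -mulrA mulrDl mul1r.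
rewrite dM in f2 *.
move: (18 * c * c3) (18 * c * C_L * c4) (M / ln 2) (K%:R * ln T%:R) (K%:R * M) KM f1 f2.
move=> a1 a2 a3 L KM h1 h2 h3; lra.
Qed.

End total_regret.

Theorem corollary9 (R : realType) (C_L M : R) (hC_L : 0 < C_L) (hM : 0 < M) :
  exists2 C : R, 0 < C &
    forall (F : exp_family R),
      regular_log_partition F ->
      lipschitz_variance F C_L M ->
    forall (K T : nat), (2 <= K)%N -> (2 <= T)%N ->
    forall (theta : 'I_K -> R),
      (forall a, bounded_params F M (theta a)) ->
    forall (d : measure_display) (Om : measurableType d) (P : probability Om R)
      (I : nat -> Om -> 'I_K) (r : nat -> Om -> R),
      exp_kl_ms_run F I r P (fun a => member F (theta a)) T ->
      let mu := fun a => mean F (theta a) in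
      (regret I P mu T <=
        (C * (Num.sqrt (variance_fun F (max_arm mu) * K%:R * T%:R * ln K%:R)
              + K%:R * ln T%:R))%:E)%E.
Proof.
pose c : R := 19 + 48 * expR 4.
have c0 : 0 <= c by rewrite addr_ge0// mulr_ge0// expR_ge0.
have ln2 : 0 < ln (2 : R) by rewrite ln_gt0// ltr1n.
exists (1 + 18 * c * (3 + 3 / ln 2) + (2 * M / ln 2 +
    18 * c * C_L * (1 + (1 + ln (1 + M / (18 * C_L))) / ln 2))).
  have h1 : 0 <= 18 * c * (3 + 3 / ln 2).
    by rewrite mulr_ge0 ?mulr_ge0// addr_ge0// divr_ge0// ltW.
  have h2 : 0 < 2 * M / ln 2 by rewrite divr_gt0// mulr_gt0.
  have h3 : 0 <= 18 * c * C_L * (1 + (1 + ln (1 + M / (18 * C_L))) / ln 2).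
    rewrite mulr_ge0 ?mulr_ge0 ?(ltW hC_L)// addr_ge0// divr_ge0 ?(ltW ln2)//.
    by rewrite addr_ge0// ln_ge0// lerDl divr_ge0 ?(ltW hM)// mulr_ge0 ?(ltW hC_L).
  by rewrite ltr_pwDl ?addr_ge0// ?(ltW h2)// ltr_pwDl.
move=> F regF lipF K T K2 T2 theta btheta d Om P I r run; cbv zeta.
set mu := fun a => mean F (theta a).
have K0 : (0 < K)%N by exact: ltnW.
have mI := run_measI run.
have [best mubest] := max_arm_attained mu K0.
rewrite (regretE P mI) lee_fin mubest.
apply: (sum_regret_le hC_L hM (variance_fun_ge0 F _) K2 T2
  (p := fun t a => pr P (I t @^-1` [set a])) (D := fun a => mu best - mu a)) => //.
- by move=> t a; exact: pr_ge0.
- by move=> t tT; exact: (sum_pr_arm P mI tT).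
- by move=> a; rewrite -mubest subr_ge0 max_arm_ge.
- move=> a; have [_ /andP[a0 _]] := btheta a; have [_ /andP[_ bM]] := btheta best.
  by rewrite (le_trans _ bM)// gerBl ltW.
- by move=> a; exact: (gap_pulls_le run K0 hC_L regF lipF btheta).
Qed.
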